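(* Let $p>2$. For every noncompact graph $\mathcal{G}\in\mathbf{G}$, every set $Z\subseteq\mathbb{V}\setminus\mathbb{V}_\infty$ of vertices of degree $1$, and every $\lambda>-\omega_Z(\mathcal{G})$, $$\inf_{v\in\mathcal{M}_{\lambda,Z}(\mathcal{G})}J_\lambda(v)\ \ge\ 2\inf_{v\in\mathcal{N}_{\lambda,Z}(\mathcal{G})}J_\lambda(v).$$ If equality holds, then $\mathcal{G}$ admits no nodal ground states of $J_\lambda$ in $\mathcal{M}_{\lambda,Z}(\mathcal{G})$.
   Context: $\mathbf{G}$ is the class of connected metric graphs $\mathcal{G}=(\mathbb{V},\mathbb{E})$ with at most countably many edges and vertices, every vertex of finite degree, and edge lengths bounded away from $0$: $\inf_{e\in\mathbb{E}}\ell_e>0$. Edges are bounded intervals or half-lines; each half-line is considered to end at a vertex at infinity of degree $1$, $\mathbb{V}_\infty$ is the set of these vertices, and they are not points of the metric space $\mathcal{G}$. $\mathcal{G}$ is noncompact if it has at least one half-line or infinitely many edges. $Z\subseteq\mathbb{V}\setminus\mathbb{V}_\infty$ is a (possibly empty or infinite) set of degree $1$ vertices. $H^1(\mathcal{G})$ is the space of continuous real functions on $\mathcal{G}$ that are $H^1$ on each edge with finite total $H^1$ norm, and $H^1_Z(\mathcal{G})=\{u\in H^1(\mathcal{G}): u(\mathrm{v})=0\ \forall\,\mathrm{v}\in Z\}$. Define $$\omega_Z(\mathcal{G})=\inf_{v\in H^1_Z(\mathcal{G})\setminus\{0\}}\frac{\|v'\|_{L^2(\mathcal{G})}^2}{\|v\|_{L^2(\mathcal{G})}^2},\qquad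 J_\lambda(u)=\tfrac12\|u'\|_{L^2(\mathcal{G})}^2+\tfrac{\lambda}{2}\|u\|_{L^2(\mathcal{G})}^2-\tfrac1p\|u\|_{L^p(\mathcal{G})}^p ,$$ $$\mathcal{N}_{\lambda,Z}(\mathcal{G})=\{u\in H^1_Z(\mathcal{G}): u\neq0,\ \|u'\|_{L^2}^2+\lambda\|u\|_{L^2}^2=\|u\|_{L^p}^p\},$$ $$\mathcal{M}_{\lambda,Z}(\mathcal{G})=\{u\in H^1_Z(\mathcal{G}): u^+,u^-\in\mathcal{N}_{\lambda,Z}(\mathcal{G})\},\quad u^+=\max(u,0),\ u^-=\min(u,0).$$ A nodal ground state is $u\in\mathcal{M}_{\lambda,Z}(\mathcal{G})$ with $J_\lambda(u)=\inf_{\mathcal{M}_{\lambda,Z}(\mathcal{G})}J_\lambda$. *)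

(* Defs.v *)
From HB Require Import structures.
From Stdlib Require Relation_Operators.
From mathcomp Require Import all_boot all_order all_algebra.
From mathcomp Require Import finmap.
From mathcomp Require Import all_classical all_reals all_analysis.

Set Implicit Arguments.
Unset Strict Implicit.
Unset Printing Implicit Defensive.

Import Order.TTheory GRing.Theory Num.Theory.
Import numFieldNormedType.Exports.

Local Open Scope classical_set_scope.
Local Open Scope ring_scope.

(* Loops and multiple edges are allowed. The edge e is the interval of length
   [len e], identified with [0, len e] in such a way that 0 is at [src e] and
   the other end at [tgt e]; it is a half-line [0, +oo[ when [len e = +oo], and
   then [tgt e] is its vertex at infinity. *)
Record metric_graph (R : realType) := MetricGraph {
  vertex : countType;
  edge : countType;
  src : edge -> vertex;
  tgt : edge -> vertex;
  len : edge -> \bar R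
}.

Section MetricGraph.
Variables (R : realType) (G : metric_graph R).
Implicit Types (e : edge G) (v : vertex G).

(* The half-edge (e, false) is the end of e at [src e], and (e, true) the end
   at [tgt e]. *)
Definition half_edge : Type := (edge G * bool)%type.

Definition endpoint (h : half_edge) : vertex G :=
  if h.2 then tgt h.1 else src h.1.

Definition star v : set half_edge := [set h | endpoint h = v].

(* A loop counts twice. Meaningful only if [star v] is finite. *)
Definition degree v : nat := #|` fset_set (star v)|%fset.

Definition Vinf : set (vertex G) :=
  [set v | exists2 e, len e = +oo%E & tgt e = v].

Definition connected_graph : Prop := forall v w,
  Relation_Operators.clos_refl_sym_trans (vertex G)
    (fun v w => exists2 e, src e = v & tgt e = w) v w.

Definition class_G : Prop :=
  [/\ connected_graph,
      forall v, finite_set (star v),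
      forall v, Vinf v -> degree v = 1%N &
      (0 < ereal_inf (range (@len R G)))%E].

Definition noncompact_graph : Prop :=
  (exists e, len e = +oo%E) \/ infinite_set [set: edge G].

Definition edge_closed e : set R := [set x | 0 <= x /\ (x%:E <= len e)%E].
Definition edge_open e : set R := [set x | 0 < x /\ (x%:E < len e)%E].

(* A function on the graph is a family indexed by the edges; the values of
   [u e] outside of [edge_closed e] are irrelevant. *)
Definition gfun : Type := edge G -> R -> R.
Implicit Types u : gfun.

Definition gnonzero u : Prop := exists e x, edge_closed e x /\ u e x != 0.

(* Value at the end h of the edge [h.1], if that end is not at infinity. *)
Definition trace u (h : half_edge) : R :=
  u h.1 (if h.2 then fine (len h.1) else 0).

Definition gcontinuous u : Prop :=
  (forall e, {within edge_closed e, continuous (u e)}) /\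
  (forall h1 h2 : half_edge, endpoint h1 = endpoint h2 ->
     ~ Vinf (endpoint h1) -> trace u h1 = trace u h2).

(* C^1 functions with compact support in the open edge: in dimension one they
   define the same weak derivatives as smooth test functions. *)
Definition test_function e (phi : R -> R) : Prop :=
  [/\ forall x, derivable phi x 1,
      continuous (derive1 phi) &
      exists a b, [/\ edge_open e a, edge_open e b &
        forall x, x < a \/ b < x -> phi x = 0]].

Definition is_weak_derivative e (f g : R -> R) : Prop :=
  [/\ measurable_fun (edge_open e) g,
      (\int[@lebesgue_measure R]_(x in edge_open e) (g x ^+ 2)%:E < +oo)%E &
      forall phi, test_function e phi ->
        \int[@lebesgue_measure R]_(x in edge_open e) (f x * derive1 phi x)
        = - \int[@lebesgue_measure R]_(x in edge_open e) (g x * phi x)].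

(* The derivative u', chosen on each edge among its almost everywhere equal
   representatives. *)
Definition gderiv u : gfun := fun e =>
  xget (cst 0 : R -> R) [set g : R -> R | is_weak_derivative e (u e) g].

(* The q-th power of the L^q norm on the graph. *)
Definition Lqpow (q : R) u : \bar R :=
  (\esum_(e in [set: edge G])
     \int[@lebesgue_measure R]_(x in edge_open e) (`|u e x| `^ q)%:E)%E.

Definition H1 : set gfun := [set u |
  [/\ gcontinuous u,
      forall e, exists g, is_weak_derivative e (u e) g,
      (Lqpow 2 u < +oo)%E &
      (Lqpow 2 (gderiv u) < +oo)%E]].

Definition gpos u : gfun := fun e x => Num.max (u e x) 0.
Definition gneg u : gfun := fun e x => Num.min (u e x) 0.

Variable Z : set (vertex G).

Definition H1Z : set gfun := [set u |
  H1 u /\ forall h : half_edge, Z (endpoint h) -> trace u h = 0].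

Definition omega : \bar R :=
  ereal_inf [set (Lqpow 2 (gderiv v) / Lqpow 2 v)%E
            | v in [set v | H1Z v /\ gnonzero v]].

Variables p lambda : R.

(* Extended real-valued by definition, but finite on H1 when G is in [class_G]
   and 2 <= p, by the embedding of H1 in the bounded functions. *)
Definition J u : \bar R :=
  ((2^-1)%:E * Lqpow 2 (gderiv u) + (lambda / 2)%:E * Lqpow 2 u
   - (p^-1)%:E * Lqpow p u)%E.

Definition nehari : set gfun := [set u |
  [/\ H1Z u, gnonzero u &
      (Lqpow 2 (gderiv u) + lambda%:E * Lqpow 2 u = Lqpow p u)%E]].

Definition nodal_nehari : set gfun := [set u |
  [/\ H1Z u, nehari (gpos u) & nehari (gneg u)]].

Definition nodal_ground_state u : Prop :=
  nodal_nehari u /\ J u = ereal_inf [set J v | v in nodal_nehari].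

End MetricGraph.

(* Main.v *)
Require Import Defs.
From HB Require Import structures.
From mathcomp Require Import all_boot all_order all_algebra.
From mathcomp Require Import all_classical all_reals all_analysis.
From mathcomp Require Import finmap ring lra measurable_realfun.
Import Order.TTheory GRing.Theory Num.Theory.
Import numFieldNormedType.Exports.
Local Open Scope classical_set_scope.
Local Open Scope ring_scope.
Set Implicit Arguments.
Unset Strict Implicit.
Unset Printing Implicit Defensive.

(** If [u] is nodal then [u^+] and [u^-] lie in the Nehari set and, since the
derivative of [u^+] vanishes almost everywhere on [{u <= 0}],
[J u = J (u^+) + J (u^-)], which gives the inequality. If equality holds and [u]
is a nodal ground state, then [w = u^+] is a ground state over the Nehari set,
nonnegative, that vanishes inside some edge. The strong maximum principle
forbids this. It is obtained here without regularity theory: for [phi >= 0], adding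
[s phi] to [w] does not decrease the [L^p] norm, so by rescaling to the Nehari
set it cannot decrease [Q v = |v'|^2 + lambda |v|^2], whence
[<w', phi'> + lambda <w, phi> >= 0]. For [phi] a tent of radius [r] around a
zero of [w] this bounds the sum of the values of [w] at distance [r] by
[C r^2 sup w]; for small [r] the supremum is at most half of itself, so [w]
vanishes near its zero. Zeros thus propagate along the edges and through the
vertices. *)

(** * Smooth steps *)

(** Weak derivatives are made pointwise: [f y - f x] is recovered as the integral of [g], and
    Lebesgue differentiation then shows that [g] is almost everywhere the classical derivative.
    Uniqueness and the lack of cross terms between [u^+] and [u^-] follow. The graph may have
    infinitely many edges, so perturbations are supported by finitely many of them and change the
    energy by a finite sum.

    Perturbations are taken nonnegative so that they cannot decrease the [L^p] norm, which leaves a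
    one-sided inequality. A tent turns it into a local bound: at a zero of [w >= 0] the pairing
    [<w', phi'>] is [- 1 / r] times the sum of the values at distance [r], and the term with
    [lambda] is of order [r sup w], whence the factor [r^2]. At a vertex the tents on all half-edges
    make up one continuous function. It is not admissible at a vertex of [Z] and makes no sense at
    infinity, but there the degree is 1 and no further edge is left to reach. *)

Section spline.
Variable R : realType.
Implicit Types (t x : R).

(** The truncated square, the building block of quadratic splines: it is C^1 and vanishes on a
    half-line. *)
Definition psq t : R := Num.max 0 t ^+ 2.

Lemma is_derive_psq t : is_derive t 1 psq (2 * Num.max 0 t).
Proof.
have [t0|t0|<-] := ltgtP 0 t.
- have E : {near t, (fun x => x ^+ 2) =1 psq}.
    near=> x; rewrite /psq max_r//; apply: ltW; near: x; exact: lt_nbhsr.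
  apply: (near_eq_is_derive E).
  apply: is_derive_eq; rewrite /GRing.scale/=; lra.
- have E : {near t, (fun x => 0) =1 psq}.
    near=> x; rewrite /psq max_l ?expr0n//; apply: ltW; near: x; exact: lt_nbhsl.
  apply: (near_eq_is_derive E).
  by rewrite mulr0; apply: is_derive_cst.
- rewrite mulr0.
  (* At the corner the difference quotient is at most [|h|] in absolute value. *)
  have H : h^-1 *: (psq (h *: 1 + 0) - psq 0) @[h --> 0^'] --> (0 : R).
    apply/cvgr0Pnorm_le => e e0; near=> h.
    have h0 : h != 0 by near: h; exact: nbhs_dnbhs_neq.
    rewrite /GRing.scale/= mulr1 addr0 /psq maxxx expr0n subr0 normrM normfV.
    have : `|h| <= e by near: h; apply: dnbhs0_le.
    apply: le_trans; rewrite ler_pdivrMl ?normr_gt0// -expr2 normrX.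
    rewrite lerXn2r ?nnegrE//; case: (leP 0 h) => hh; last by rewrite normr0.
    by [].
  apply: DeriveDef; first by apply/cvg_ex; exists 0.
  exact: cvg_lim.
Unshelve. all: by end_near. Qed.

(* The C^1 quadratic spline rising from 0 to 1 on [0, 1]. *)
Definition sstep t : R := 2 * psq t - 4 * psq (t - 2^-1) + 2 * psq (t - 1).
Definition sstep' t : R :=
  4 * (Num.max 0 t - 2 * Num.max 0 (t - 2^-1) + Num.max 0 (t - 1)).

Lemma is_derive_sstep t : is_derive t 1 sstep (sstep' t).
Proof.
have Hc (a : R) : is_derive t 1 (fun s => psq (s - a)) (2 * Num.max 0 (t - a)).
  have H1 : is_derive t 1 (fun s : R => s - a) 1.
    by apply: is_derive_eq; rewrite subr0.
  have := @is_derive1_comp R psq (fun s : R => s - a) t _ _ (is_derive_psq (t - a)) H1.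
  by rewrite /comp mulr1.
pose f := (2 *: psq - 4 *: (fun s => psq (s - 2^-1)) + 2 *: (fun s => psq (s - 1))) : R -> R.
have -> : sstep = f by [].
have HH : is_derive t 1 f (2 *: (2 * Num.max 0 t) - 4 *: (2 * Num.max 0 (t - 2^-1))
  + 2 *: (2 * Num.max 0 (t - 1))).
  have H0 := is_derive_psq t; have Hh := Hc 2^-1; have H1 := Hc 1.
  by apply: is_deriveD; apply: is_deriveB.
apply: is_derive_eq; rewrite /GRing.scale/= /sstep'; ring.
Qed.

Lemma sstep_le0 t : t <= 0 -> sstep t = 0.
Proof. by move=> t0; rewrite /sstep /psq !max_l; lra. Qed.

Lemma sstep_ge1 t : 1 <= t -> sstep t = 1.
Proof. by move=> t1; rewrite /sstep /psq !max_r; [|lra..]; field. Qed.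

Lemma sstep'_ge0 t : 0 <= sstep' t.
Proof.
rewrite /sstep'.
by case: (leP 0 t) => ?; case: (leP 0 (t - 2^-1)) => ?; case: (leP 0 (t - 1)) => ?; lra.
Qed.

Lemma sstep'_out t : t <= 0 \/ 1 <= t -> sstep' t = 0.
Proof. by case=> t0; rewrite /sstep'; [rewrite !max_l|rewrite !max_r]; lra. Qed.

Lemma continuous_sstep' : continuous sstep'.
Proof.
have Hm a : continuous (fun t : R => Num.max 0 (t - a)).
  move=> t; apply: (@continuous_max R R (cst 0) (fun s => s - a)).
    exact: cvg_cst.
  by apply: cvgB; [exact: cvg_id|exact: cvg_cst].
move=> t; rewrite /sstep'; apply: cvgM; first exact: cvg_cst.
apply: cvgD; last exact: Hm.
apply: cvgB; last by apply: cvgM; [exact: cvg_cst|exact: Hm].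
have -> : Num.max 0 = (fun x : R => Num.max 0 (x - 0)) by apply/funext => x; rewrite subr0.
exact: Hm.
Qed.

Lemma sstep_bound t : 0 <= sstep t <= 1.
Proof.
rewrite /sstep /psq.
by case: (leP 0 t) => ?; case: (leP 0 (t - 2^-1)) => ?; case: (leP 0 (t - 1)) => ?; nra.
Qed.
End spline.

(** * Integrals on the line *)

Section real_integrals.
Variable R : realType.
Notation mu := (@lebesgue_measure R).
Implicit Types (f g h r : R -> R) (A D : set R).

Lemma Rintegral_support {D A h} : A `<=` D ->
  (forall x, D x -> ~ A x -> h x = 0) ->
  \int[mu]_(x in D) h x = \int[mu]_(x in A) h x.
Proof.
move=> AD h0; rewrite Rintegral_mkcond [RHS]Rintegral_mkcond.
apply: eq_Rintegral => x _; rewrite !patchE.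
case: ifPn => /= [|/negP] xD; case: ifPn => /= [|/negP] xA //.
  by rewrite h0//; [exact: set_mem|move=> ?; apply: xA; exact: mem_set].
by exfalso; apply: xD; apply: mem_set; apply: AD; exact: set_mem.
Qed.

Lemma integrable_support {D A h} : measurable D -> measurable A -> A `<=` D ->
  (forall x, D x -> ~ A x -> h x = 0) ->
  mu.-integrable A (EFin \o h) -> mu.-integrable D (EFin \o h).
Proof.
move=> mD mA AD h0 ihA.
have ih := (@integrable_mkcond _ _ _ mu A (EFin \o h) mA).1 ihA.
apply: (@integrable_mkcond _ _ _ mu D (EFin \o h) mD).2; apply: eq_integrable ih => // x _.
rewrite !patchE.
case: ifPn => /= [|/negP] xA; case: ifPn => /= [|/negP] xD //.
  by exfalso; apply: xD; apply: mem_set; apply: AD; exact: set_mem.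
by rewrite h0//; [exact: set_mem|move=> ?; apply: xA; exact: mem_set].
Qed.

Lemma integrable_addr {f g D} : measurable D -> mu.-integrable D (EFin \o f) ->
  mu.-integrable D (EFin \o g) ->
  mu.-integrable D (EFin \o (fun x => f x + g x)).
Proof. by move=> mD fi gi; exact: (@integrableD _ _ _ mu D mD _ _ fi gi). Qed.

Lemma integrable_scaler {f D} (k : R) : measurable D ->
  mu.-integrable D (EFin \o f) -> mu.-integrable D (EFin \o (fun x => k * f x)).
Proof. by move=> mD fi; exact: (@integrableZl _ _ _ mu D mD k _ fi). Qed.

Lemma integrable_le {f h D} : measurable D -> measurable_fun D f ->
  (forall x, D x -> `|f x| <= h x) -> mu.-integrable D (EFin \o h) ->
  mu.-integrable D (EFin \o f).
Proof.
move=> mD mf fh ih; apply: (@le_integrable _ _ _ mu D mD _ (EFin \o h) _ _ ih).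
  exact/measurable_EFinP.
by move=> x Dx /=; rewrite lee_fin (le_trans (fh x Dx))// ler_norm.
Qed.

Lemma itv_integrable {f} {a b : R} : {within `[a, b], continuous f} ->
  mu.-integrable `[a, b] (EFin \o f).
Proof. by apply: continuous_compact_integrable; exact: segment_compact. Qed.

Lemma within_continuousM {f g A} : {within A, continuous f} ->
  {within A, continuous g} -> {within A, continuous (fun x => f x * g x)}.
Proof. by move=> cf cg x; apply: cvgM; [exact: cf|exact: cg]. Qed.

Lemma within_continuousD {f g A} : {within A, continuous f} ->
  {within A, continuous g} -> {within A, continuous (fun x => f x + g x)}.
Proof. by move=> cf cg x; apply: cvgD; [exact: cf|exact: cg]. Qed.

(** The density [r] will be a slope of a bump, which has mass one and concentrates at an endpoint as
    the bump sharpens. *)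
Lemma weighted_mean_dist {f r} {a b c eta : R} :
  {within `[a, b], continuous f} -> {within `[a, b], continuous r} ->
  (forall t, a <= t <= b -> 0 <= r t) -> \int[mu]_(t in `[a, b]) r t = 1 ->
  (forall t, a <= t <= b -> `|f t - c| <= eta) ->
  `|\int[mu]_(t in `[a, b]) (f t * r t) - c| <= eta.
Proof.
move=> cf cr r0 r1 fc.
have ir := itv_integrable cr.
have ifr := itv_integrable (within_continuousM cf cr).
have L k : \int[mu]_(t in `[a, b]) (k * r t) = k by rewrite RintegralZl// r1 mulr1.
have ik k : mu.-integrable `[a, b] (EFin \o (fun t => k * r t)).
  exact: integrable_scaler.
rewrite ler_distl -(L (c - eta)) -(L (c + eta)); apply/andP; split.
  apply: le_Rintegral => // t /=; rewrite in_itv/= => tab.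
  by apply: ler_wpM2r; [exact: r0|have := fc t tab; rewrite ler_distl => /andP[]].
apply: le_Rintegral => // t /=; rewrite in_itv/= => tab.
by apply: ler_wpM2r; [exact: r0|have := fc t tab; rewrite ler_distl => /andP[]].
Qed.

(** On a set of finite measure the bound [|g| <= g^2 + 1] is enough. *)
Lemma sqr_integrable_integrable {g D A} : measurable D -> measurable A ->
  A `<=` D -> (mu A < +oo)%E -> measurable_fun D g ->
  (\int[mu]_(x in D) (g x ^+ 2)%:E < +oo)%E ->
  mu.-integrable A (EFin \o g).
Proof.
move=> mD mA AD muA mg g2.
have i2 : mu.-integrable A (EFin \o (fun x => g x ^+ 2)).
  apply: (@integrableS _ _ _ mu _ _ _ mD mA AD); apply/integrableP; split.
    by apply/measurable_EFinP; exact: measurable_funX.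
  by under eq_integral do rewrite /= ger0_norm ?sqr_ge0//.
have i1 : mu.-integrable A (EFin \o (cst 1)).
  by apply: measurable_bounded_integrable => //; exact: bounded_cst.
apply: (integrable_le mA _ _ (integrable_addr mA i2 i1)).
  exact: measurable_funS mg.
move=> x _ /=.
rewrite -(real_normK (num_real (g x))); have := normr_ge0 (g x).
by move: `|g x| => y y0; nra.
Qed.

End real_integrals.

(** * Weak derivatives on an edge *)

Section weak_derivatives.
Variables (R : realType) (G : metric_graph R) (e : edge G).
Notation mu := (@lebesgue_measure R).
Implicit Types (f g h : R -> R) (x y t eps : R).

Lemma measurable_edge_open : measurable (edge_open e).
Proof.
rewrite /edge_open; case: (len e) => [l| |].
- rewrite (_ : [set _ | _] = `]0, l[%classic); first exact: measurable_itv.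
  by apply/seteqP; split => x /=; rewrite in_itv/= lte_fin; [case=> -> ->|case/andP].
- rewrite (_ : [set _ | _] = `]0, +oo[%classic); first exact: measurable_itv.
  by apply/seteqP; split => x /=; rewrite in_itv/= andbT ltry; [case|move=> ->].
- rewrite (_ : [set _ | _] = set0); first exact: measurable0.
  by apply/seteqP; split => x //=; case.
Qed.

Lemma edge_open_closed : edge_open e `<=` edge_closed e.
Proof. by move=> x [x0 xl]; split; exact: ltW. Qed.

Lemma edge_closed_itv {x y : R} : edge_closed e x -> edge_closed e y ->
  `[x, y] `<=` edge_closed e.
Proof.
move=> [x0 _] [_ yl] z /=; rewrite in_itv/= => /andP[xz zy]; split.
  exact: le_trans xz.
by apply: le_trans yl; rewrite lee_fin.
Qed.

Lemma edge_closed_itv_open {x y : R} : edge_closed e x -> edge_closed e y ->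
  `]x, y[ `<=` edge_open e.
Proof.
move=> [x0 _] [_ yl] z /=; rewrite in_itv/= => /andP[xz zy]; split.
  exact: le_lt_trans xz.
by apply: lt_le_trans yl; rewrite lte_fin.
Qed.

(* Rises on [x + eps, x + 2 eps] and falls on [y - 2 eps, y - eps]. *)
Definition bump (x y eps t : R) : R :=
  sstep ((t - x) / eps - 1) + sstep ((y - t) / eps - 1) - 1.

Definition up (x eps t : R) : R := sstep' ((t - x) / eps - 1) / eps.
Definition down (y eps t : R) : R := sstep' ((y - t) / eps - 1) / eps.

Lemma is_derive_up x eps t :
  is_derive t 1 (fun s => sstep ((s - x) / eps - 1)) (up x eps t).
Proof.
have H1 : is_derive t 1 (fun s : R => (s - x) / eps - 1) eps^-1.
  have -> : (fun s : R => (s - x) / eps - 1) = (eps^-1 *: (fun s : R => s - x) - cst 1).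
    by apply/funext => s; rewrite !fctE /GRing.scale/= mulrC.
  by apply: is_derive_eq; rewrite /GRing.scale/= !subr0 mulr1.
exact: (@is_derive1_comp R _ _ t _ _ (is_derive_sstep _) H1).
Qed.

Lemma is_derive_down y eps t :
  is_derive t 1 (fun s => sstep ((y - s) / eps - 1)) (- down y eps t).
Proof.
have H2 : is_derive t 1 (fun s : R => (y - s) / eps - 1) (- eps^-1).
  have -> : (fun s : R => (y - s) / eps - 1) = (eps^-1 *: (fun s : R => y - s) - cst 1).
    by apply/funext => s; rewrite !fctE /GRing.scale/= mulrC.
  by apply: is_derive_eq; rewrite /GRing.scale/=; ring.
by rewrite /down -mulrN; exact: (@is_derive1_comp R _ _ t _ _ (is_derive_sstep _) H2).
Qed.

Lemma is_derive_bump (x y eps t : R) :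
  is_derive t 1 (bump x y eps) (up x eps t - down y eps t).
Proof.
have D1 := is_derive_up x eps t; have D2 := is_derive_down y eps t.
have -> : bump x y eps = (fun s => sstep ((s - x) / eps - 1)) +
  (fun s => sstep ((y - s) / eps - 1)) - cst 1 by [].
by apply: is_derive_eq; rewrite subr0.
Qed.

Lemma continuous_up x eps : continuous (up x eps).
Proof.
move=> t; apply: cvgM; last exact: cvg_cst.
apply: (@continuous_comp _ _ _ (fun t : R => (t - x) / eps - 1) (@sstep' R)).
  apply: cvgB; last exact: cvg_cst.
  apply: cvgM; last exact: cvg_cst.
  by apply: cvgB; [exact: cvg_id|exact: cvg_cst].
exact: continuous_sstep'.
Qed.

Lemma continuous_down y eps : continuous (down y eps).
Proof.
move=> t; apply: cvgM; last exact: cvg_cst.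
apply: (@continuous_comp _ _ _ (fun t : R => (y - t) / eps - 1) (@sstep' R)).
  apply: cvgB; last exact: cvg_cst.
  apply: cvgM; last exact: cvg_cst.
  by apply: cvgB; [exact: cvg_cst|exact: cvg_id].
exact: continuous_sstep'.
Qed.

(** The condition [4 * eps <= y - x] keeps the two slopes apart: where one step is 0, the other has
    already reached 1. *)
Lemma bump_out x y eps t : 0 < eps -> 4 * eps <= y - x ->
  t <= x + eps \/ y - eps <= t -> bump x y eps t = 0.
Proof.
move=> eps0 xy; have L u : (u / eps - 1 <= 0) = (u <= eps).
  by rewrite subr_le0 ler_pdivrMr// mul1r.
have G1 u : (1 <= u / eps - 1) = (2 * eps <= u).
  by rewrite lerBrDr ler_pdivlMr// mulrDl mul1r -mulr2n mulr_natl.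
rewrite /bump; case=> H.
  have -> : sstep ((t - x) / eps - 1) = 0 by apply: sstep_le0; rewrite L; lra.
  have -> : sstep ((y - t) / eps - 1) = 1 by apply: sstep_ge1; rewrite G1; lra.
  lra.
have -> : sstep ((t - x) / eps - 1) = 1 by apply: sstep_ge1; rewrite G1; lra.
have -> : sstep ((y - t) / eps - 1) = 0 by apply: sstep_le0; rewrite L; lra.
lra.
Qed.

Lemma bump_bound x y eps t : `|bump x y eps t| <= 1.
Proof.
rewrite /bump ler_norml; have := sstep_bound ((t - x) / eps - 1).
by have := sstep_bound ((y - t) / eps - 1); lra.
Qed.

Lemma bump1 x y eps t : 0 < eps -> x + 2 * eps <= t <= y - 2 * eps -> bump x y eps t = 1.
Proof.
move=> eps0; have G1 u : (1 <= u / eps - 1) = (2 * eps <= u).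
  by rewrite lerBrDr ler_pdivlMr// mulrDl mul1r -mulr2n mulr_natl.
by move=> H; rewrite /bump !sstep_ge1 ?G1 ?addrK//; lra.
Qed.

Lemma up_out x eps t : 0 < eps -> t <= x + eps \/ x + 2 * eps <= t -> up x eps t = 0.
Proof.
move=> eps0 H; rewrite /up sstep'_out ?mul0r//; case: H => H; [left|right].
  by rewrite subr_le0 ler_pdivrMr// mul1r; lra.
by rewrite lerBrDr ler_pdivlMr//; lra.
Qed.

Lemma down_out y eps t : 0 < eps -> t <= y - 2 * eps \/ y - eps <= t -> down y eps t = 0.
Proof.
move=> eps0 H; rewrite /down sstep'_out ?mul0r//; case: H => H; [right|left].
  by rewrite lerBrDr ler_pdivlMr//; lra.
by rewrite subr_le0 ler_pdivrMr// mul1r; lra.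
Qed.

(** The margin [eps] left at either side keeps the support inside the open edge even when [x] or [y]
    is an end of the closed edge. *)
Lemma test_function_bump x y eps : 0 < eps -> 4 * eps <= y - x ->
  edge_closed e x -> edge_closed e y ->
  test_function e (bump x y eps).
Proof.
move=> eps0 xy ex ey; split.
- by move=> t; case: (is_derive_bump x y eps t).
- have -> : derive1 (bump x y eps) = (fun t => up x eps t - down y eps t).
    by apply/funext => t; rewrite derive1E; case: (is_derive_bump x y eps t).
  by move=> t; apply: cvgB; [exact: continuous_up|exact: continuous_down].
- exists (x + eps), (y - eps); split.
  + by apply: (edge_closed_itv_open ex ey); rewrite /= in_itv/=; lra.
  + by apply: (edge_closed_itv_open ex ey); rewrite /= in_itv/=; lra.
  + by move=> t H; apply: bump_out; lra.
Qed.

Lemma integral_up x eps : 0 < eps ->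
  \int[mu]_(t in `[x + eps, x + 2 * eps]) up x eps t = 1.
Proof.
move=> eps0; pose F t := sstep ((t - x) / eps - 1).
have dF t : derivable F t 1 by case: (is_derive_up x eps t).
have cF : continuous F by move=> t; apply: differentiable_continuous; apply/derivable1_diffP.
rewrite /Rintegral (@continuous_FTC2 _ _ F)/=; first last.
- by move=> t _; rewrite derive1E; case: (is_derive_up x eps t).
- by split; [move=> t _; exact: dF|apply: cvg_at_right_filter; exact: cF|
     apply: cvg_at_left_filter; exact: cF].
- by apply: continuous_subspaceT; exact: continuous_up.
- lra.
rewrite /F sstep_ge1 ?sstep_le0 ?subr0//.
  by rewrite subr_le0 ler_pdivrMr// mul1r; lra.
by rewrite lerBrDr ler_pdivlMr//; lra.
Qed.

Lemma integral_down y eps : 0 < eps ->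
  \int[mu]_(t in `[y - 2 * eps, y - eps]) down y eps t = 1.
Proof.
move=> eps0; pose F t := - sstep ((y - t) / eps - 1).
have isF t : is_derive t 1 F (down y eps t).
  rewrite -[X in is_derive _ _ _ X]opprK; have := is_derive_down y eps t.
  exact: is_deriveN.
have dF t : derivable F t 1 by case: (isF t).
have cF : continuous F by move=> t; apply: differentiable_continuous; apply/derivable1_diffP.
rewrite /Rintegral (@continuous_FTC2 _ _ F)/=; first last.
- by move=> t _; rewrite derive1E; case: (isF t).
- by split; [move=> t _; exact: dF|apply: cvg_at_right_filter; exact: cF|
     apply: cvg_at_left_filter; exact: cF].
- by apply: continuous_subspaceT; exact: continuous_down.
- lra.
rewrite /F sstep_le0 ?sstep_ge1 ?oppr0 ?sub0r ?opprK//.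
  by rewrite lerBrDr ler_pdivlMr//; lra.
by rewrite subr_le0 ler_pdivrMr// mul1r; lra.
Qed.
Lemma within_continuous_dist f (A : set R) x (eta : R) : {within A, continuous f} ->
  A x -> 0 < eta -> exists2 delta, 0 < delta &
    forall t, A t -> `|t - x| < delta -> `|f t - f x| <= eta.
Proof.
move=> /subspace_continuousP cf Ax eta0.
have /cvgrPdist_le/(_ eta eta0) := cf x Ax.
rewrite near_withinE => /nbhs_ballP[d /= d0 H]; exists d => // t At tx.
by rewrite distrC; apply: H => //; rewrite /ball/= distrC.
Qed.

(** The derivative of the bump is the difference of two probability densities, one near [x] and one
    near [y], so the pairing is a difference of two local means of [f]. *)
Lemma bump_pairing_dist f x y (E eta : R) : edge_closed e x -> edge_closed e y ->
  0 < E -> 4 * E <= y - x -> {within edge_closed e, continuous f} ->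
  (forall t, edge_closed e t -> `|t - x| <= 2 * E -> `|f t - f x| <= eta) ->
  (forall t, edge_closed e t -> `|t - y| <= 2 * E -> `|f t - f y| <= eta) ->
  `|\int[mu]_(t in edge_open e) (f t * derive1 (bump x y E) t) - (f x - f y)|
    <= 2 * eta.
Proof.
move=> ex ey E0 E4 cf H1 H2.
have xyO := edge_closed_itv_open ex ey; have xyC := edge_closed_itv ex ey.
have sC (a b : R) : x <= a -> b <= y -> `[a, b] `<=` edge_closed e.
  move=> xa by_ t; rewrite /= in_itv/= => /andP[at_ tb]; apply: xyC.
  by rewrite /= in_itv/= (le_trans xa)// (le_trans tb).
pose A := `[x + E, y - E]%classic : set R.
have AO : A `<=` edge_open e.
  move=> t; rewrite /A/= in_itv/= => tA; apply: xyO; rewrite /= in_itv/=; lra.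
have cfA : {within A, continuous f} by apply: continuous_subspaceW cf; apply: sC; lra.
have cuA : {within A, continuous (up x E)}.
  by apply: continuous_subspaceT; exact: continuous_up.
have cdA : {within A, continuous (down y E)}.
  by apply: continuous_subspaceT; exact: continuous_down.
have derE t : derive1 (bump x y E) t = up x E t - down y E t.
  by rewrite derive1E; case: (is_derive_bump x y E t).
have -> : \int[mu]_(t in edge_open e) (f t * derive1 (bump x y E) t) =
    \int[mu]_(t in `[x + E, x + 2 * E]) (f t * up x E t) -
    \int[mu]_(t in `[y - 2 * E, y - E]) (f t * down y E t).
  rewrite (Rintegral_support AO); last first.
    move=> t Ot nt; rewrite derE.
    have H : t <= x + E \/ y - E <= t.
      have [tx|xt] := leP t (x + E); [by left|right].
      by rewrite leNgt; apply/negP => ty; apply: nt; rewrite /A/= in_itv/= !ltW.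
    rewrite up_out ?down_out ?subrr ?mulr0//; case: H; [left|right|left|right]; lra.
  under eq_Rintegral do rewrite derE mulrBr.
  rewrite RintegralB; first last.
  - by apply: itv_integrable; exact: within_continuousM.
  - by apply: itv_integrable; exact: within_continuousM.
  - exact: measurable_itv.
  rewrite (@Rintegral_support _ A `[x + E, x + 2 * E]); first last.
  - move=> t; rewrite /A/= !in_itv/= => tA nt; rewrite up_out ?mulr0//.
    by have [tx|xt] := leP t (x + 2 * E); [exfalso; apply: nt; lra|right; lra].
  - by move=> t; rewrite /A/= !in_itv/=; lra.
  rewrite (@Rintegral_support _ A `[y - 2 * E, y - E]) //.
  - by move=> t; rewrite /A/= !in_itv/=; lra.
  - move=> t; rewrite /A/= !in_itv/= => tA nt; rewrite down_out ?mulr0//.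
    by have [tx|xt] := leP (y - 2 * E) t; [exfalso; apply: nt; lra|left; lra].
have M1 : `|\int[mu]_(t in `[x + E, x + 2 * E]) (f t * up x E t) - f x| <= eta.
  apply: weighted_mean_dist.
  - by apply: continuous_subspaceW cf; apply: sC; lra.
  - by apply: continuous_subspaceT; exact: continuous_up.
  - by move=> t _; rewrite /up divr_ge0 ?sstep'_ge0// ltW.
  - exact: integral_up.
  - move=> t tab; apply: H1; first by apply: xyC; rewrite /= in_itv/=; lra.
    by rewrite ler_norml; lra.
have M2 : `|\int[mu]_(t in `[y - 2 * E, y - E]) (f t * down y E t) - f y| <= eta.
  apply: weighted_mean_dist.
  - by apply: continuous_subspaceW cf; apply: sC; lra.
  - by apply: continuous_subspaceT; exact: continuous_down.
  - by move=> t _; rewrite /down divr_ge0 ?sstep'_ge0// ltW.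
  - exact: integral_down.
  - move=> t tab; apply: H2; first by apply: xyC; rewrite /= in_itv/=; lra.
    by rewrite ler_norml; lra.
by move: M1 M2; rewrite !ler_norml; lra.
Qed.

(* The bumps are test functions converging to the indicator of ]x, y[. *)
Lemma integral_weak_derivative f g x y : edge_closed e x -> edge_closed e y ->
  x < y -> {within edge_closed e, continuous f} -> is_weak_derivative e f g ->
  \int[mu]_(t in `]x, y[) g t = f y - f x.
Proof.
move=> ex ey xy cf [mg g2 wg].
have xyO := edge_closed_itv_open ex ey; have xyC := edge_closed_itv ex ey.
have ig : mu.-integrable `]x, y[ (EFin \o g).
  apply: (sqr_integrable_integrable measurable_edge_open _ xyO _ mg g2) => //.
  by rewrite lebesgue_measure_itv/= lte_fin xy -EFinB ltry.
pose eps n : R := (y - x) / 4 / n.+1%:R.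
have eps0 n : 0 < eps n by rewrite !divr_gt0// subr_gt0.
have eps4 n : 4 * eps n <= y - x.
  rewrite /eps mulrC -!mulrA ler_piMr ?subr_ge0 ?(ltW xy)//.
  rewrite mulrCA mulVf ?mulr1 ?invf_le1 ?ler1n//.
have cvg_eps : eps n @[n --> \oo] --> 0.
  rewrite -[X in _ --> X](mulr0 ((y - x) / 4)).
  by apply: cvgM; [exact: cvg_cst|exact: (@cvg_harmonic R)].
have mbump n : measurable_fun setT (bump x y (eps n)).
  apply: continuous_measurable_fun => t.
  apply: differentiable_continuous; apply/derivable1_diffP.
  by case: (is_derive_bump x y (eps n) t).
have mgxy : measurable_fun `]x, y[ g.
  exact: (measurable_funS measurable_edge_open xyO).
have mgb n : measurable_fun `]x, y[ (fun t => g t * bump x y (eps n) t).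
  by apply: measurable_funM => //; exact: measurable_funTS.
pose I n := \int[mu]_(t in `]x, y[) (g t * bump x y (eps n) t).
(* Dominated convergence with bound [|g|]: the bumps are at most 1 in absolute value and, at each
   point of []x, y[], eventually equal to 1. *)
have cI : I n @[n --> \oo] --> \int[mu]_(t in `]x, y[) g t.
  apply: fine_cvg; rewrite fineK; last exact: integrable_fin_num.
  apply: (@dominated_cvg _ _ _ mu _ _ _ _ (fun t => `|g t|%:E)) => //=.
  - by move=> n; apply/measurable_EFinP; exact: mgb.
  - move=> t; rewrite in_itv/= => /andP[xt ty]; apply: cvg_EFin; first exact: nearW.
    apply: cvg_near_cst; near=> n => /=.
    rewrite bump1 ?mulr1//.
    have : eps n <= (t - x) / 2 by near: n; apply: cvgr_le cvg_eps _ _; lra.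
    have : eps n <= (y - t) / 2 by near: n; apply: cvgr_le cvg_eps _ _; lra.
    lra.
  - exact: (@integrable_norm _ _ _ mu).
  - move=> n t txy; rewrite lee_fin normrM ler_piMr// bump_bound//.
(* By the definition of weak derivative the same sequence is minus the pairing of [f] with the
   derivatives of the bumps, and that pairing tends to [f x - f y]. *)
apply: (cvg_unique _ cI) => //.
have EI n : I n = - \int[mu]_(t in edge_open e) (f t * derive1 (bump x y (eps n)) t).
  rewrite wg; last exact: test_function_bump.
  rewrite opprK [RHS](Rintegral_support xyO)// => t Ot nt.
  rewrite bump_out ?mulr0//; have := eps0 n; have := eps4 n.
  have : t <= x \/ y <= t.
    have [tx|xt] := leP t x; [by left|right].
    by rewrite leNgt; apply/negP => ty; apply: nt; rewrite /= in_itv/= xt ty.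
  by case=> ?; lra.
apply/cvgrPdist_le => eta eta0.
have e2 : 0 < eta / 2 by rewrite divr_gt0.
have [d1 d10 H1] := within_continuous_dist cf ex e2.
have [d2 d20 H2] := within_continuous_dist cf ey e2.
near=> n.
have En1 : eps n < d1 / 2 by near: n; apply: cvgr_lt cvg_eps _ _; lra.
have En2 : eps n < d2 / 2 by near: n; apply: cvgr_lt cvg_eps _ _; lra.
rewrite EI.
have [H1' H2'] : (forall t, edge_closed e t -> `|t - x| <= 2 * eps n -> `|f t - f x| <= eta / 2) /\
   (forall t, edge_closed e t -> `|t - y| <= 2 * eps n -> `|f t - f y| <= eta / 2).
  by split=> t et tx; [apply: H1|apply: H2] => //; lra.
have := bump_pairing_dist ex ey (eps0 n) (eps4 n) cf H1' H2'.
by rewrite !ler_norml; lra.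
Unshelve. all: by end_near. Qed.

(** * Classical derivatives almost everywhere, and linearity of the weak derivative *)

Lemma near_edge_open x : edge_open e x -> \forall y \near x, edge_open e y.
Proof.
move=> [x0 xl].
have [c xc cl] : exists2 c, x < c & (c%:E <= len e)%E.
  by case: (len e) xl => [l| |]//= xl; [exists l|exists (x + 1); rewrite ?ltrDl ?leey].
near=> y; split; first by near: y; exact: lt_nbhsr.
by apply: lt_le_trans cl; rewrite lte_fin; near: y; exact: lt_nbhsl.
Unshelve. all: by end_near. Qed.

(** By [integral_weak_derivative], [f] is a primitive of [g], so Lebesgue differentiation applies.
    It is used for functions integrable on the line, hence the truncation of [g] to []0, n[]: on a
    half-line a square integrable [g] may fail to be integrable. Countably many null sets are then
    collected. *)
Lemma ae_is_derive f g : {within edge_closed e, continuous f} ->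
  is_weak_derivative e f g ->
  {ae mu, forall x, edge_open e x -> is_derive x 1 f (g x)}.
Proof.
move=> cf wfg; have [mg g2 _] := wfg.
suff H n : {ae mu, forall x, edge_open e x -> x < n%:R -> is_derive x 1 f (g x)}.
  have /ae_foralln := H; apply: filterS => x Hx Ox.
  by apply: (Hx (Num.truncn x).+1) => //; rewrite truncnS_gt.
pose B := edge_open e `&` `]0, n%:R[%classic.
have mB : measurable B by apply: measurableI; [exact: measurable_edge_open|exact: measurable_itv].
have iB : mu.-integrable B (EFin \o g).
  apply: (sqr_integrable_integrable measurable_edge_open mB _ _ mg g2).
    exact: subIsetl.
  apply: (@le_lt_trans _ _ (mu `]0, n%:R[)); last first.
    by rewrite lebesgue_measure_itv/=; case: ifPn => // _; rewrite -EFinB ltry.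
  have mI : measurable (`]0, n%:R[%classic : set R) by exact: measurable_itv.
  by apply: (@le_measure _ _ _ mu B _ (mem_set mB) (mem_set mI)); exact: subIsetr.
have iG : mu.-integrable setT (EFin \o (g \_ B)).
  by rewrite -restrict_EFin; apply/(@integrable_mkcond _ _ _ mu B _ mB).1.
have lG : locally_integrable setT (g \_ B) by exact: integrable_locally.
have iGy (y : R) : mu.-integrable `]-oo, y] (EFin \o (g \_ B)).
  exact: (@integrableS _ _ _ mu setT).
have := FTC1Ny iGy lG.
apply: filterS; first exact: (ae_filter_ringOfSetsType mu).
move=> x [dF F'] Ox xn.
have e0 : edge_closed e 0.
  by split => //; case: Ox => x0 xl; apply: ltW; apply: lt_trans xl.
have gx : (g \_ B) x = g x.
  by rewrite patchE mem_set//; split => //=; rewrite in_itv/= xn andbT; case: Ox.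
have := (@DeriveDef _ _ _ _ _ _ _ dF (erefl _)).
rewrite -derive1E F' gx => isF.
have E : {near x, (fun y => f 0 + \int[mu]_(t in `]-oo, y]) (g \_ B) t) =1 f}.
  near=> y.
  have [y0 yl] : edge_open e y by near: y; exact: near_edge_open.
  have yn : y < n%:R by near: y; exact: lt_nbhsl.
  have ey : edge_closed e y by split; exact: ltW.
  rewrite -Rintegral_itv_bndo_bndc; last exact: (@integrableS _ _ _ mu setT).
  rewrite (@Rintegral_support _ _ `]0, y[); first last.
  - move=> t /=; rewrite !in_itv/= => ty nt; rewrite patchE memNset// /B/= in_itv/=.
    by move=> [[t0 _] _]; apply: nt; rewrite t0.
  - by move=> t /=; rewrite !in_itv/= => /andP[].
  rewrite (_ : \int[mu]_(t in _) _ = \int[mu]_(t in `]0, y[) g t); last first.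
    apply: eq_Rintegral => t /set_mem/=; rewrite in_itv/= => /andP[t0 ty].
    rewrite patchE mem_set//; split; last by rewrite /= in_itv/= t0 (lt_trans ty).
    by split => //; apply: lt_trans yl; rewrite lte_fin.
  by rewrite (integral_weak_derivative e0 ey y0 cf wfg) addrC subrK.
apply: (near_eq_is_derive E).
rewrite -[g x]add0r; exact: (is_deriveD (is_derive_cst (f 0) x 1) isF).
Unshelve. all: by end_near. Qed.

Lemma test_function_derive_out (phi : R -> R) (a b : R) x :
  (forall x, x < a \/ b < x -> phi x = 0) -> x < a \/ b < x ->
  derive1 phi x = 0.
Proof.
move=> phi0 H; have E : {near x, (fun=> 0) =1 phi}.
  case: H => H; near=> y; rewrite phi0//; [left|right]; near: y.
  - exact: lt_nbhsl.
  - exact: lt_nbhsr.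
have D : is_derive x 1 phi 0 by exact: (near_eq_is_derive E).
by rewrite derive1E; case: D.
Unshelve. all: by end_near. Qed.

Lemma integrable_test_deriv f phi : {within edge_closed e, continuous f} ->
  test_function e phi ->
  mu.-integrable (edge_open e) (EFin \o (fun x => f x * derive1 phi x)).
Proof.
move=> cf [_ cphi [a [b [Oa Ob phi0]]]].
have ea := edge_open_closed Oa; have eb := edge_open_closed Ob.
have sub : `[a, b] `<=` edge_open e.
  case: Oa Ob => a0 _ [_ bl] t; rewrite /= in_itv/= => /andP[at_ tb]; split.
    exact: lt_le_trans at_.
  by apply: le_lt_trans bl; rewrite lee_fin.
apply: (integrable_support measurable_edge_open (measurable_itv _) sub).
  move=> x Ox nx; rewrite (test_function_derive_out phi0) ?mulr0//.
  have [|ax] := ltP x a; [by left|right].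
  by rewrite ltNge; apply/negP => xb; apply: nx; rewrite /= in_itv/= ax.
apply: itv_integrable; apply: within_continuousM.
  by apply: continuous_subspaceW cf; exact: edge_closed_itv.
exact: continuous_subspaceT.
Qed.

Lemma integrable_test g phi : measurable_fun (edge_open e) g ->
  (\int[mu]_(x in edge_open e) (g x ^+ 2)%:E < +oo)%E ->
  test_function e phi ->
  mu.-integrable (edge_open e) (EFin \o (fun x => g x * phi x)).
Proof.
move=> mg g2 [dphi _ [a [b [Oa Ob phi0]]]].
have cphi : continuous phi.
  by move=> t; apply: differentiable_continuous; apply/derivable1_diffP.
have mphi : measurable_fun setT phi by exact: continuous_measurable_fun.
have sub : `[a, b] `<=` edge_open e.
  case: Oa Ob => a0 _ [_ bl] t; rewrite /= in_itv/= => /andP[at_ tb]; split.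
    exact: lt_le_trans at_.
  by apply: le_lt_trans bl; rewrite lee_fin.
have ia : measurable (`[a, b]%classic : set R) by exact: measurable_itv.
have i1 : mu.-integrable `[a, b] (EFin \o g).
  apply: (sqr_integrable_integrable measurable_edge_open ia sub _ mg g2).
  by rewrite lebesgue_measure_itv/=; case: ifPn => // _; rewrite -EFinB ltry.
have i2 : mu.-integrable `[a, b] (EFin \o (fun x => phi x ^+ 2)).
  apply: itv_integrable; apply: continuous_subspaceT => t.
  by apply: cvgM; exact: cphi.
have i3 : mu.-integrable `[a, b] (EFin \o (fun x => g x ^+ 2)).
  apply: (@integrableS _ _ _ mu _ _ _ measurable_edge_open ia sub); apply/integrableP; split.
    by apply/measurable_EFinP; exact: measurable_funX.
  by under eq_integral do rewrite /= ger0_norm ?sqr_ge0//.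
apply: (integrable_support measurable_edge_open ia sub).
  move=> x Ox nx; rewrite phi0 ?mulr0//.
  have [|ax] := ltP x a; [by left|right].
  by rewrite ltNge; apply/negP => xb; apply: nx; rewrite /= in_itv/= ax.
apply: (integrable_le ia _ _ (integrable_addr ia i3 i2)).
  apply: measurable_funM; last exact: measurable_funTS.
  exact: (measurable_funS measurable_edge_open sub).
move=> x _; rewrite normrM -(real_normK (num_real (g x))) -(real_normK (num_real (phi x))).
by have := normr_ge0 (g x); have := normr_ge0 (phi x); nra.
Qed.

Lemma sqr_integrableD g h : measurable_fun (edge_open e) g ->
  measurable_fun (edge_open e) h ->
  (\int[mu]_(x in edge_open e) (g x ^+ 2)%:E < +oo)%E ->
  (\int[mu]_(x in edge_open e) (h x ^+ 2)%:E < +oo)%E ->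
  (\int[mu]_(x in edge_open e) ((g x + h x) ^+ 2)%:E < +oo)%E.
Proof.
move=> mg mh g2 h2.
have mO := measurable_edge_open.
apply: (@le_lt_trans _ _ (\int[mu]_(x in edge_open e) ((2%:E * (g x ^+ 2)%:E) + (2%:E * (h x ^+ 2)%:E)))%E).
  apply: ge0_le_integral => //.
  - by move=> x _; rewrite lee_fin sqr_ge0.
  - apply/measurable_EFinP; apply: measurable_funX; exact: measurable_funD.
  - apply/emeasurable_funD; apply/measurable_EFinP; apply: measurable_funM => //; exact: measurable_funX.
  - move=> x _; rewrite -!EFinM -EFinD lee_fin; have := sqr_ge0 (g x - h x); nra.
rewrite ge0_integralD//.
- rewrite !ge0_integralZl//; first last.
  + by move=> x _; rewrite lee_fin sqr_ge0.
  + by apply/measurable_EFinP; exact: measurable_funX.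
  + by move=> x _; rewrite lee_fin sqr_ge0.
  + by apply/measurable_EFinP; exact: measurable_funX.
  by rewrite lte_add_pinfty// lte_mul_pinfty// ?lee_fin.
- by move=> x _; rewrite -EFinM lee_fin mulr_ge0 ?sqr_ge0.
- by apply/measurable_EFinP; apply: measurable_funM => //; exact: measurable_funX.
- by move=> x _; rewrite -EFinM lee_fin mulr_ge0 ?sqr_ge0.
- by apply/measurable_EFinP; apply: measurable_funM => //; exact: measurable_funX.
Qed.

Lemma is_weak_derivativeD f1 f2 g1 g2 : {within edge_closed e, continuous f1} ->
  {within edge_closed e, continuous f2} -> is_weak_derivative e f1 g1 ->
  is_weak_derivative e f2 g2 ->
  is_weak_derivative e (fun x => f1 x + f2 x) (fun x => g1 x + g2 x).
Proof.
move=> c1 c2 [m1 l1 w1] [m2 l2 w2]; have mO := measurable_edge_open; split.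
- exact: measurable_funD.
- exact: sqr_integrableD.
- move=> phi tphi.
  under eq_Rintegral do rewrite mulrDl.
  rewrite RintegralD//; [|exact: integrable_test_deriv..].
  under [in RHS]eq_Rintegral do rewrite mulrDl.
  rewrite RintegralD//; [|exact: integrable_test..].
  by rewrite w1// w2// opprD.
Qed.

Lemma is_weak_derivativeZ k f g : {within edge_closed e, continuous f} ->
  is_weak_derivative e f g ->
  is_weak_derivative e (fun x => k * f x) (fun x => k * g x).
Proof.
move=> cf [mg lg wg]; have mO := measurable_edge_open; split.
- exact: measurable_funM.
- under eq_integral do rewrite exprMn EFinM.
  rewrite ge0_integralZl ?lee_fin ?sqr_ge0//.
  + by rewrite lte_mul_pinfty// lee_fin sqr_ge0.
  + by apply/measurable_EFinP; exact: measurable_funX.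
  + by move=> x _; rewrite lee_fin sqr_ge0.
- move=> phi tphi.
  under eq_Rintegral do rewrite -mulrA.
  rewrite RintegralZl//; last exact: integrable_test_deriv.
  under [in RHS]eq_Rintegral do rewrite -mulrA.
  rewrite RintegralZl//; last exact: integrable_test.
  by rewrite wg// mulrN.
Qed.
(** Almost everywhere both are the classical derivative of [f]. *)
Lemma weak_derivative_unique f g h : {within edge_closed e, continuous f} ->
  is_weak_derivative e f g -> is_weak_derivative e f h ->
  {ae mu, forall x, edge_open e x -> g x = h x}.
Proof.
move=> cf wg wh; have := ae_is_derive cf wh; have := ae_is_derive cf wg.
apply: filterS2; first exact: (ae_filter_ringOfSetsType mu).
move=> x H1 H2 Ox.
by have := H1 Ox; have := H2 Ox => -[_ <-] [_ <-].
Qed.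

Lemma is_derive_max_eq0 f (x d : R) : is_derive x 1 f d ->
  (forall y, f y <= f x) -> d = 0.
Proof.
move=> [df <-] fx.
have cd : h^-1 *: (f (h *: 1 + x) - f x) @[h --> 0^'] --> 'D_1 f x by exact: df.
apply/eqP; case: (ltgtP ('D_1 f x) 0) => // D0; exfalso.
- have : \forall h \near 0^', h^-1 *: (f (h *: 1 + x) - f x) < 0 by apply: cvgr_lt cd _ D0.
  rewrite /dnbhs near_withinE => /nbhs_ballP[s /= s0 Hs].
  have /Hs : ball 0 s (- (s / 2)).
    by rewrite /ball/= sub0r opprK ger0_norm; lra.
  move=> /(_ _); rewrite oppr_eq0 gt_eqF ?divr_gt0// => /(_ isT).
  rewrite /GRing.scale/= mulr1 ltNge => /negP; apply.
  rewrite invrN mulNr -mulrN mulr_ge0 ?invr_ge0 ?divr_ge0 ?(ltW s0)//.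
  by rewrite oppr_ge0 subr_le0.
- have : \forall h \near 0^', 0 < h^-1 *: (f (h *: 1 + x) - f x) by apply: cvgr_gt cd _ D0.
  rewrite /dnbhs near_withinE => /nbhs_ballP[s /= s0 Hs].
  have /Hs : ball 0 s (s / 2).
    by rewrite /ball/= sub0r normrN ger0_norm; lra.
  move=> /(_ _); rewrite gt_eqF ?divr_gt0// => /(_ isT).
  rewrite /GRing.scale/= mulr1 ltNge => /negP; apply.
  by rewrite mulr_ge0_le0 ?invr_ge0 ?divr_ge0 ?(ltW s0)// subr_le0.
Qed.

(* Where [f] vanishes the nonnegative function [max f 0] has a minimum, so its
   derivative is zero there, and likewise for [min f 0]. *)
Lemma weak_derivative_posneg f g gp gn :
  {within edge_closed e, continuous f} ->
  {within edge_closed e, continuous (fun x => Num.max (f x) 0)} ->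
  {within edge_closed e, continuous (fun x => Num.min (f x) 0)} ->
  is_weak_derivative e f g ->
  is_weak_derivative e (fun x => Num.max (f x) 0) gp ->
  is_weak_derivative e (fun x => Num.min (f x) 0) gn ->
  {ae mu, forall x, edge_open e x -> g x ^+ 2 = gp x ^+ 2 + gn x ^+ 2}.
Proof.
move=> cf cp cn wf wp wn.
have A1 := ae_is_derive cf wf; have A2 := ae_is_derive cp wp.
have A3 := ae_is_derive cn wn.
move: A1 A2 A3; apply: filterS3; first exact: (ae_filter_ringOfSetsType mu).
move=> x H1 H2 H3 Ox.
have {}H1 := H1 Ox; have {}H2 := H2 Ox; have {}H3 := H3 Ox.
have fE : f = (fun x => Num.max (f x) 0) + (fun x => Num.min (f x) 0).
  by apply/funext => y; rewrite [RHS]addr_max_min addr0.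
have gE : g x = gp x + gn x.
  have [_ <-] := H1; have [_ <-] := is_deriveD H2 H3.
  exact: (congr1 (fun h => derive h x 1) fE).
(* In either case one of [gp x] and [gn x] is zero, so the square of their sum has no cross term. *)
have [f0|f0] := leP 0 (f x).
  have gn0 : gn x = 0.
    by apply: (is_derive_max_eq0 H3) => y; rewrite (min_r f0) ge_min lexx orbT.
  by rewrite gE gn0 expr0n !addr0.
have gp0 : - gp x = 0.
  apply: (is_derive_max_eq0 (is_deriveN H2)) => y; rewrite !fctE (max_r (ltW f0)) oppr0.
  by rewrite oppr_le0 le_max lexx orbT.
by rewrite gE -[gp x]opprK gp0 oppr0 expr0n !add0r.
Qed.

End weak_derivatives.

(** * Tent functions *)

Section tents.
Variables (R : realType) (G : metric_graph R) (e : edge G).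
Notation mu := (@lebesgue_measure R).
Implicit Types (f g h phi : R -> R) (a c r x : R).

Definition ramp a x : R := Num.max 0 (x - a).

Lemma continuous_ramp a : continuous (ramp a).
Proof.
move=> t; apply: (@continuous_max R R (cst 0) (fun s => s - a)).
  exact: cvg_cst.
by apply: cvgB; [exact: cvg_id|exact: cvg_cst].
Qed.

Lemma integrable_bounded_test g phi : measurable_fun (edge_open e) g ->
  (forall x, `|g x| <= 1) -> test_function e phi ->
  mu.-integrable (edge_open e) (EFin \o (fun x => g x * phi x)).
Proof.
move=> mg g1 [dphi _ [a [b [Oa Ob phi0]]]].
have cphi : continuous phi.
  by move=> t; apply: differentiable_continuous; apply/derivable1_diffP.
have mphi : measurable_fun setT phi by exact: continuous_measurable_fun.
have sub : `[a, b] `<=` edge_open e.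
  case: Oa Ob => a0 _ [_ bl] t; rewrite /= in_itv/= => /andP[at_ tb]; split.
    exact: lt_le_trans at_.
  by apply: le_lt_trans bl; rewrite lee_fin.
have ia : measurable (`[a, b]%classic : set R) by exact: measurable_itv.
apply: (integrable_support (measurable_edge_open e) ia sub).
  move=> x Ox nx; rewrite phi0 ?mulr0//.
  have [|ax] := ltP x a; [by left|right].
  by rewrite ltNge; apply/negP => xb; apply: nx; rewrite /= in_itv/= ax.
have i2 : mu.-integrable `[a, b] (EFin \o (fun x => `|phi x|)).
  by apply: integrable_norm; apply: itv_integrable; exact: continuous_subspaceT.
apply: (integrable_le ia _ _ i2).
  apply: measurable_funM; last exact: measurable_funTS.
  exact: (measurable_funS (measurable_edge_open e) sub).
by move=> x _; rewrite normrM ler_piMl.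
Qed.

Lemma measurable_ge a (D : set R) : measurable D ->
  measurable_fun D (fun x : R => (a <= x)%R%:R : R).
Proof.
move=> mD; apply: measurable_funTS.
rewrite (_ : (fun x => _) = \1_(`[a, +oo[%classic)); first exact: measurable_indic.
by apply/funext => x; rewrite indicE /= mem_setE in_itv/= andbT.
Qed.

Lemma measurable_gt a (D : set R) : measurable D ->
  measurable_fun D (fun x : R => (a < x)%R%:R : R).
Proof.
move=> mD; apply: measurable_funTS.
rewrite (_ : (fun x => _) = \1_(`]a, +oo[%classic)); first exact: measurable_indic.
by apply/funext => x; rewrite indicE /= mem_setE in_itv/= andbT.
Qed.

(** The two step functions differ only at the point [a]; both versions are stated because [tent']
    uses the strict inequality at some corners and the large one at others. *)
Lemma ramp_by_parts a phi : test_function e phi ->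
  (\int[mu]_(x in edge_open e) (ramp a x * derive1 phi x) =
    - \int[mu]_(x in edge_open e) ((a < x)%R%:R * phi x)) /\
  (\int[mu]_(x in edge_open e) (ramp a x * derive1 phi x) =
    - \int[mu]_(x in edge_open e) ((a <= x)%R%:R * phi x)).
Proof.
move=> tphi; have [dphi cdphi [al [be [Oa Ob phi0]]]] := tphi.
have cphi : continuous phi.
  by move=> t; apply: differentiable_continuous; apply/derivable1_diffP.
(* A point beyond both [a] and the support of [phi]: integrating by parts on [[a, B]] leaves no
   boundary term, since the ramp vanishes at [a] and [phi] at [B]. *)
pose B := Num.max a be + 1.
have aB : a < B by rewrite /B ltr_pwDr// le_max lexx.
have beB : be < B by rewrite /B ltr_pwDr// le_max lexx orbT.
(* The corner [a] may lie outside the edge; as [phi] vanishes off the edge, all integrals can be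
   taken over the line. *)
have extend k : (forall x, x < al \/ be < x -> k x = 0) ->
    \int[mu]_(x in edge_open e) k x = \int[mu]_x k x.
  move=> k0; rewrite [RHS](@Rintegral_support _ _ (edge_open e))//.
  move=> x _ nOx; apply: k0.
  have [|ax] := ltP x al; [by left|right].
  rewrite ltNge; apply/negP => xb; apply: nOx; case: Oa Ob => a0 _ [_ bl]; split.
    exact: lt_le_trans ax.
  by apply: le_lt_trans bl; rewrite lee_fin.
have dphi0 x : x < al \/ be < x -> derive1 phi x = 0.
  exact: test_function_derive_out.
have L : \int[mu]_(x in edge_open e) (ramp a x * derive1 phi x) =
    - \int[mu]_(x in `[a, B]) phi x.
  rewrite extend; last by move=> x /dphi0 ->; rewrite mulr0.
  rewrite (@Rintegral_support _ _ `[a, B])//; last first.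
    move=> x _ nx; have [xa|ax] := ltP x a.
      by rewrite /ramp max_l ?mul0r// subr_le0 ltW.
    rewrite dphi0 ?mulr0//; right.
    apply: lt_trans beB _; rewrite ltNge; apply/negP => xb; apply: nx.
    by rewrite /= in_itv/= ax.
  have -> : \int[mu]_(x in `[a, B]) (ramp a x * derive1 phi x) =
      \int[mu]_(x in `[a, B]) ((x - a) * derive1 phi x).
    apply: eq_Rintegral; move=> x /set_mem/=; rewrite in_itv/= => /andP[ax _].
    by rewrite /ramp max_r// subr_ge0.
  have isd x : is_derive x 1 (fun x : R => x - a) 1.
    by apply: is_derive_eq; rewrite subr0.
  have c1 : {within `[a, B], continuous (cst 1 : R -> R)}.
    by apply: continuous_subspaceT => x; exact: cvg_cst.
  have dF : derivable_oo_LRcontinuous (fun x : R => x - a) a B.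
    split; first by move=> x _; case: (isd x).
      apply: cvg_at_right_filter; apply: cvgB; [exact: cvg_id|exact: cvg_cst].
    apply: cvg_at_left_filter; apply: cvgB; [exact: cvg_id|exact: cvg_cst].
  have e1 : {in `]a, B[, (fun x : R => x - a)^`()%classic =1 cst 1}.
    by move=> x _; rewrite derive1E; case: (isd x).
  have c2 : {within `[a, B], continuous (derive1 phi)} by exact: continuous_subspaceT.
  have dG : derivable_oo_LRcontinuous phi a B.
    split; first by move=> x _.
      by apply: cvg_at_right_filter; exact: cphi.
    by apply: cvg_at_left_filter; exact: cphi.
  have e2 : {in `]a, B[, phi^`()%classic =1 derive1 phi} by move=> x _.
  rewrite (Rintegration_by_parts aB c1 dF e1 c2 dG e2).
  rewrite (phi0 B); last by right.
  rewrite subrr mul0r mulr0 subrr sub0r; congr (- _).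
  by apply: eq_Rintegral => x _; rewrite mul1r.
have G1 : \int[mu]_(x in edge_open e) ((a <= x)%R%:R * phi x) = \int[mu]_(x in `[a, B]) phi x.
  rewrite extend; last by move=> x /phi0 ->; rewrite mulr0.
  rewrite (@Rintegral_support _ _ `[a, B])//; last first.
    move=> x _ nx; have [ax|_] := leP a x; last by rewrite mul0r.
    rewrite phi0 ?mulr0//; right.
    apply: lt_trans beB _; rewrite ltNge; apply/negP => xb; apply: nx.
    by rewrite /= in_itv/= ax.
  by apply: eq_Rintegral => x /set_mem/=; rewrite in_itv/= => /andP[-> _]; rewrite mul1r.
have G2 : \int[mu]_(x in edge_open e) ((a < x)%R%:R * phi x) = \int[mu]_(x in `[a, B]) phi x.
  rewrite -Rintegral_itv_obnd_cbnd; last first.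
    apply: (@integrableS _ _ _ mu `[a, B]) => //.
      by move=> x /=; rewrite !in_itv/= => /andP[/ltW -> ->].
    by apply: itv_integrable; exact: continuous_subspaceT.
  rewrite extend; last by move=> x /phi0 ->; rewrite mulr0.
  rewrite (@Rintegral_support _ _ `]a, B])//; last first.
    move=> x _ nx; have [ax|_] := ltP a x; last by rewrite mul0r.
    rewrite phi0 ?mulr0//; right.
    apply: lt_trans beB _; rewrite ltNge; apply/negP => xb; apply: nx.
    by rewrite /= in_itv/= ax.
  by apply: eq_Rintegral => x /set_mem/=; rewrite in_itv/= => /andP[-> _]; rewrite mul1r.
by rewrite L G1 G2.
Qed.

(** The second difference of the ramp at scale [r], divided by [r]. In this form its weak derivative
    comes from that of [ramp] by linearity. *)
Definition tent c r x : R :=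
  r^-1 * (ramp (c - r) x - ramp c x - ramp c x + ramp (c + r) x).

(* With this mixture of strict and large inequalities [tent'] is a combination
   of the indicators of the open intervals ]c - r, c[ and ]c, c + r[. *)
Definition tent' c r x : R :=
  r^-1 * ((c - r < x)%R%:R - (c < x)%R%:R - (c <= x)%R%:R + (c + r <= x)%R%:R).

Lemma tent_bound c r x : 0 < r -> 0 <= tent c r x <= 1.
Proof.
move=> r0; rewrite /tent /ramp.
suff : 0 <= Num.max 0 (x - (c - r)) - Num.max 0 (x - c) - Num.max 0 (x - c) +
   Num.max 0 (x - (c + r)) <= r.
  move=> /andP[H1 H2]; rewrite mulr_ge0 ?invr_ge0 ?(ltW r0)//=.
  by rewrite mulrC ler_pdivrMr// mul1r.
by case: (leP 0 (x - (c - r))) => ?; case: (leP 0 (x - c)) => ?; case: (leP 0 (x - (c + r))) => ?; lra.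
Qed.

Lemma tent_out c r x : 0 < r -> r <= `|x - c| -> tent c r x = 0.
Proof.
move=> r0; rewrite ler_normr => H; rewrite /tent /ramp.
apply/eqP; rewrite mulf_eq0; apply/orP; right; apply/eqP.
case: (leP 0 (x - (c - r))) => ?; case: (leP 0 (x - c)) => ?; case: (leP 0 (x - (c + r))) => ?; try lra.
all: case/orP: H => H; lra.
Qed.

Lemma tent_center c r : 0 < r -> tent c r c = 1.
Proof.
move=> r0; rewrite /tent /ramp.
have -> : Num.max 0 (c - (c - r)) = r by rewrite max_r; lra.
have -> : Num.max 0 (c - (c + r)) = 0 by rewrite max_l; lra.
by rewrite subrr maxxx !subr0 addr0 mulVf ?gt_eqF.
Qed.

Lemma continuous_tent c r : continuous (tent c r).
Proof.
move=> x; apply: cvgM; first exact: cvg_cst.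
apply: cvgD; last exact: continuous_ramp.
apply: cvgB; last exact: continuous_ramp.
by apply: cvgB; exact: continuous_ramp.
Qed.

Lemma measurable_tent' c r : measurable_fun setT (tent' c r).
Proof.
apply: measurable_funM => //.
apply: measurable_funD; last exact: measurable_ge.
apply: measurable_funB; last exact: measurable_ge.
by apply: measurable_funB; exact: measurable_gt.
Qed.

Lemma tent'E c r x : 0 < r ->
  tent' c r x = r^-1 * ((c - r < x < c)%R%:R - (c < x < c + r)%R%:R).
Proof.
move=> r0; rewrite /tent'; congr (_ * _).
have [?|?] := ltP (c - r) x; have [?|?] := ltP c x; have [?|?] := leP c x;
  have [?|?] := leP (c + r) x; have [?|?] := ltP x c; have [?|?] := ltP x (c + r);
  rewrite /=; lra.
Qed.

Lemma tent'_sqr_lty c r : 0 < r ->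
  (\int[mu]_(x in edge_open e) (tent' c r x ^+ 2)%:E < +oo)%E.
Proof.
move=> r0.
have mI : measurable (`[c - r, c + r]%classic : set R) by exact: measurable_itv.
have i1 : mu.-integrable `[c - r, c + r] (EFin \o (fun=> r^-1 ^+ 2)).
  by apply: itv_integrable; apply: continuous_subspaceT => x; exact: cvg_cst.
have i2 : mu.-integrable `[c - r, c + r] (EFin \o (fun x => tent' c r x ^+ 2)).
  apply: (integrable_le mI _ _ i1).
    by apply: measurable_funTS; apply: measurable_funX; exact: measurable_tent'.
  move=> x _; rewrite tent'E// ger0_norm ?sqr_ge0// exprMn ler_piMr ?sqr_ge0//.
  by case: (c - r < x < c); case: (c < x < c + r); rewrite /=; nra.
have i3 : mu.-integrable setT (EFin \o (fun x => tent' c r x ^+ 2)).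
  apply: (integrable_support measurableT mI _ _ i2) => // x _ /= nx.
  have B1 : (c - r < x < c) = false by apply/negP => ?; apply: nx; rewrite in_itv/=; lra.
  have B2 : (c < x < c + r) = false by apply/negP => ?; apply: nx; rewrite in_itv/=; lra.
  by rewrite tent'E// B1 B2 subrr mulr0 expr0n.
have iO : mu.-integrable (edge_open e) (EFin \o (fun x => tent' c r x ^+ 2)).
  exact: (@integrableS _ _ _ mu setT (edge_open e) _ measurableT (measurable_edge_open e) (@subsetT _ _) i3).
exact: (@integrable_lty _ _ _ mu _ (measurable_edge_open e) _ iO).
Qed.

Lemma is_weak_derivative_tent c r : 0 < r ->
  is_weak_derivative e (tent c r) (tent' c r).
Proof.
move=> r0; split.
- by apply: measurable_funTS; exact: measurable_tent'.
- exact: tent'_sqr_lty.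
- move=> phi tphi; have mO := measurable_edge_open e.
  have ik a : mu.-integrable (edge_open e) (EFin \o (fun x => ramp a x * derive1 phi x)).
    by apply: integrable_test_deriv => //; apply: continuous_subspaceT; exact: continuous_ramp.
  have ige a : mu.-integrable (edge_open e) (EFin \o (fun x => (a <= x)%R%:R * phi x)).
    apply: integrable_bounded_test => //; first exact: measurable_ge.
    by move=> x; case: (a <= x); rewrite ?normr1 ?normr0.
  have igt a : mu.-integrable (edge_open e) (EFin \o (fun x => (a < x)%R%:R * phi x)).
    apply: integrable_bounded_test => //; first exact: measurable_gt.
    by move=> x; case: (a < x); rewrite ?normr1 ?normr0.
  have LIN (k1 k2 k3 k4 q : R -> R) :
      mu.-integrable (edge_open e) (EFin \o (fun x => k1 x * q x)) ->
      mu.-integrable (edge_open e) (EFin \o (fun x => k2 x * q x)) ->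
      mu.-integrable (edge_open e) (EFin \o (fun x => k3 x * q x)) ->
      mu.-integrable (edge_open e) (EFin \o (fun x => k4 x * q x)) ->
      \int[mu]_(x in edge_open e) (r^-1 * (k1 x - k2 x - k3 x + k4 x) * q x) =
      r^-1 * (\int[mu]_(x in edge_open e) (k1 x * q x)
       - \int[mu]_(x in edge_open e) (k2 x * q x)
       - \int[mu]_(x in edge_open e) (k3 x * q x)
       + \int[mu]_(x in edge_open e) (k4 x * q x)).
    move=> j1 j2 j3 j4.
    under eq_Rintegral do rewrite -mulrA mulrDl !mulrBl.
    have j12 : mu.-integrable (edge_open e) (EFin \o (fun x => k1 x * q x - k2 x * q x)).
      exact: (@integrableB _ _ _ mu _ mO _ _ j1 j2).
    have j123 : mu.-integrable (edge_open e) (EFin \o (fun x => k1 x * q x - k2 x * q x - k3 x * q x)).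
      exact: (@integrableB _ _ _ mu _ mO _ _ j12 j3).
    rewrite RintegralZl//; last exact: integrable_addr.
    by rewrite RintegralD// RintegralB// RintegralB.
  rewrite /tent LIN//= /tent' LIN//=.
  have [K1 _] := ramp_by_parts (c - r) tphi.
  (* The ramp at [c] occurs twice in [tent]; [tent'] replaces one copy by [c < x] and the other by
     [c <= x], so both forms are used. *)
  have [K2 K3] := ramp_by_parts c tphi.
  have [_ K4] := ramp_by_parts (c + r) tphi.
  rewrite K1 {1}K2 K3 K4; ring.
Qed.

Lemma integrable_sqr g : measurable_fun (edge_open e) g ->
  (\int[mu]_(x in edge_open e) (g x ^+ 2)%:E < +oo)%E ->
  mu.-integrable (edge_open e) (EFin \o (fun x => g x ^+ 2)).
Proof.
move=> mg g2; apply/integrableP; split.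
  by apply/measurable_EFinP; exact: measurable_funX.
by under eq_integral do rewrite /= ger0_norm ?sqr_ge0//.
Qed.

Lemma integrable_mul_sqr g h : measurable_fun (edge_open e) g ->
  measurable_fun (edge_open e) h ->
  (\int[mu]_(x in edge_open e) (g x ^+ 2)%:E < +oo)%E ->
  (\int[mu]_(x in edge_open e) (h x ^+ 2)%:E < +oo)%E ->
  mu.-integrable (edge_open e) (EFin \o (fun x => g x * h x)).
Proof.
move=> mg mh g2 h2; have mO := measurable_edge_open e.
apply: (integrable_le mO _ _ (integrable_addr mO (integrable_sqr mg g2) (integrable_sqr mh h2))).
  exact: measurable_funM.
move=> x _; rewrite normrM -(real_normK (num_real (g x))) -(real_normK (num_real (h x))).
by have := normr_ge0 (g x); have := normr_ge0 (h x); nra.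
Qed.

(** Extension by zero gives one formula for both neighbours of [c], also when [c] is an end of the
    edge and one neighbour falls outside. *)
Definition extend0 f x : R := if `[< edge_closed e x >] then f x else 0.

(** The tent has slope [1 / r] before [c] and [- 1 / r] after it, so integrating [g] on either side
    gives a difference of values of [w], and together minus a second difference, where the term
    [w c] vanishes. A side on which [c] ends the edge contributes nothing. *)
Lemma tent'_pairing (w g : R -> R) c r : {within edge_closed e, continuous w} ->
  is_weak_derivative e w g -> 0 < r -> edge_closed e c -> w c = 0 ->
  c = 0 \/ edge_closed e (c - r) -> len e = c%:E \/ edge_closed e (c + r) ->
  \int[mu]_(x in edge_open e) (g x * tent' c r x) =
    - (r^-1 * (extend0 w (c - r) + extend0 w (c + r))).
Proof.
move=> cw wwg r0 ec wc0 El Er; have [mg g2 _] := wwg.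
have mO := measurable_edge_open e.
have piece (a b : R) : a < b -> edge_closed e a -> edge_closed e b ->
    \int[mu]_(x in edge_open e) (g x * (a < x < b)%R%:R) = w b - w a.
  move=> ab ea eb; rewrite -(integral_weak_derivative ea eb ab cw wwg).
  rewrite (Rintegral_support (edge_closed_itv_open ea eb)).
    by apply: eq_Rintegral => x /set_mem/=; rewrite in_itv/= => ->; rewrite mulr1.
  by move=> x _; rewrite /= in_itv/= => /negP/negbTE ->; rewrite mulr0.
have zero (a b : R) : (forall x, edge_open e x -> (a < x < b) = false) ->
    \int[mu]_(x in edge_open e) (g x * (a < x < b)%R%:R) = 0.
  move=> H; rewrite (@Rintegral_support _ _ set0) ?Rintegral_set0//.
  by move=> x Ox _; rewrite H// mulr0.
have L : \int[mu]_(x in edge_open e) (g x * (c - r < x < c)%R%:R) = - extend0 w (c - r).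
  case: El => [c0|ecr].
    rewrite zero /extend0; last first.
      by move=> x [x0 _]; apply/negP => /andP[_]; rewrite c0; lra.
    by case: asboolP; rewrite ?oppr0// => -[]; rewrite c0; lra.
  by rewrite piece ?ltrBlDr ?ltrDl// wc0 sub0r /extend0 asboolT.
have RR : \int[mu]_(x in edge_open e) (g x * (c < x < c + r)%R%:R) = extend0 w (c + r).
  case: Er => [cl|ecr].
    rewrite zero /extend0; last first.
      by move=> x [_]; rewrite cl lte_fin => xc; apply/negP => /andP[]; lra.
    by case: asboolP; rewrite ?oppr0// => -[_]; rewrite cl lee_fin; lra.
  by rewrite piece ?ltrDl// wc0 subr0 /extend0 asboolT.
under eq_Rintegral do rewrite tent'E// mulrCA mulrBr.
have indE (a b : R) : (fun x : R => (a < x < b)%R%:R) = \1_(`]a, b[%classic) :> (R -> R).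
  by apply/funext => x; rewrite indicE /= mem_setE in_itv/=.
have ii (a b : R) : mu.-integrable (edge_open e) (EFin \o (fun x => g x * (a < x < b)%R%:R)).
  apply: integrable_mul_sqr => //.
    by apply: measurable_funTS; rewrite indE; exact: measurable_indic.
  have i1 := @integrable_indic_itv R a b false true.
  have i2 : mu.-integrable (edge_open e) (EFin \o \1_(`]a, b[%classic)).
    exact: (@integrableS _ _ _ mu setT (edge_open e) _ measurableT mO (@subsetT _ _) i1).
  have := @integrable_lty _ _ _ mu _ mO _ i2; apply: le_lt_trans.
  rewrite le_eqVlt; apply/orP; left; apply/eqP; apply: eq_integral => x _.
  by rewrite /= -indE; case: (a < x < b); rewrite ?expr1n ?expr0n.
rewrite RintegralZl//; last exact: (@integrableB _ _ _ mu _ mO _ _ (ii _ _) (ii _ _)).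
by rewrite RintegralB// L RR; ring.
Qed.

End tents.

(** * Lebesgue and Sobolev spaces on the graph *)

(** One inequality suffices for positive [k]: applied to [k^-1] it gives the other. *)
Lemma esum_scale (R : realType) (T : choiceType) (A : set T) (a : T -> \bar R) (k : R) :
  0 <= k -> (forall i, 0 <= a i)%E ->
  (\esum_(i in A) (k%:E * a i) = k%:E * \esum_(i in A) a i)%E.
Proof.
move=> k0 a0.
have le (c : R) (b : T -> \bar R) : 0 <= c -> (forall i, 0 <= b i)%E ->
    (\esum_(i in A) (c%:E * b i) <= c%:E * \esum_(i in A) b i)%E.
  move=> c0 b0; apply: ge_ereal_sup => _ [F [fF FA] <-].
  rewrite -ge0_mule_fsumr//.
  rewrite lee_wpmul2l ?lee_fin//.
  by apply: esum_ge; exists F.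
move: k0; rewrite le_eqVlt => /predU1P[<-|k0].
  by rewrite mul0e esum1// => i _; rewrite mul0e.
apply/eqP; rewrite eq_le le ?(ltW k0)//=.
have := le k^-1 (fun i => k%:E * a i)%E.
rewrite invr_ge0 (ltW k0) => /(_ isT) H.
have /(lee_wpmul2l (_ : 0 <= k%:E)%E) : (\esum_(i in A) a i <= k^-1%:E * \esum_(i in A) (k%:E * a i))%E.
  apply: le_trans (H _).
    by apply: le_esum => i Ai; rewrite muleA -EFinM mulVf ?mul1e// gt_eqF.
  by move=> i; rewrite mule_ge0 ?a0// lee_fin ltW.
by rewrite lee_fin (ltW k0) muleA -EFinM mulfV ?gt_eqF// mul1e => /(_ isT).
Qed.

Section graph_functions.
Variables (R : realType) (G : metric_graph R).
Notation mu := (@lebesgue_measure R).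
Implicit Types (e : edge G) (u v : gfun G) (q k : R).

Definition edge_Lqpow q (f : R -> R) e : \bar R :=
  (\int[mu]_(x in edge_open e) (`|f x| `^ q)%:E)%E.

Definition gmeasurable u : Prop := forall e, measurable_fun (edge_open e) (u e).

Definition gadd u v : gfun G := fun e x => u e x + v e x.
Definition gscale k u : gfun G := fun e x => k * u e x.

Lemma edge_Lqpow_ge0 q f e : (0 <= edge_Lqpow q f e)%E.
Proof. by apply: integral_ge0 => x _; rewrite lee_fin powR_ge0. Qed.

Lemma Lqpow_ge0 q u : (0 <= Lqpow q u)%E.
Proof. by apply: esum_ge0 => e _; exact: edge_Lqpow_ge0. Qed.

Lemma edge_Lqpow_le q u e : (edge_Lqpow q (u e) e <= Lqpow q u)%E.
Proof.
have := esum_ge (I := [set: edge G]) (a := fun e => edge_Lqpow q (u e) e).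
apply; exists [set e]; last by rewrite fsbig_set1.
by split => //; exact: finite_set1.
Qed.

Lemma powR2E x : (`|x| `^ 2 : R) = x ^+ 2.
Proof. by rewrite -[2]/(2%:R) powR_mulrn// real_normK// num_real. Qed.

Lemma edge_Lqpow2E f e :
  edge_Lqpow 2 f e = (\int[mu]_(x in edge_open e) (f x ^+ 2)%:E)%E.
Proof. by apply: eq_integral => x _; rewrite powR2E. Qed.

Lemma measurable_powR_norm q (f : R -> R) e : measurable_fun (edge_open e) f ->
  measurable_fun (edge_open e) (fun x => `|f x| `^ q).
Proof.
move=> mf; apply: (measurableT_comp (measurable_powR q)).
exact: measurableT_comp.
Qed.

Lemma eq_edge_Lqpow q f g e : measurable_fun (edge_open e) f ->
  measurable_fun (edge_open e) g ->
  {ae mu, forall x, edge_open e x -> f x = g x} ->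
  edge_Lqpow q f e = edge_Lqpow q g e.
Proof.
move=> mf mg fg; apply: ge0_ae_eq_integral.
- exact: measurable_edge_open.
- by apply/measurable_EFinP; exact: measurable_powR_norm.
- by apply/measurable_EFinP; exact: measurable_powR_norm.
- by move=> x _; rewrite lee_fin powR_ge0.
- by move=> x _; rewrite lee_fin powR_ge0.
- move: fg; apply: filterS; first exact: (ae_filter_ringOfSetsType mu).
  by move=> x H Ox; rewrite H.
Qed.

Lemma le_Lqpow q u v : 0 < q -> gmeasurable u -> gmeasurable v ->
  (forall e x, edge_open e x -> `|u e x| <= `|v e x|) ->
  (Lqpow q u <= Lqpow q v)%E.
Proof.
move=> q0 mu_ mv uv; apply: le_esum => e _; apply: ge0_le_integral.
- exact: measurable_edge_open.
- by move=> x _; rewrite lee_fin powR_ge0.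
- by apply/measurable_EFinP; exact: measurable_powR_norm.
- by apply/measurable_EFinP; exact: measurable_powR_norm.
- move=> x Ox; rewrite lee_fin; apply: ge0_ler_powR; rewrite ?nnegrE//.
    exact: ltW.
  exact: uv.
Qed.

Lemma Lqpow_scale q k u : gmeasurable u ->
  Lqpow q (gscale k u) = ((`|k| `^ q)%:E * Lqpow q u)%E.
Proof.
move=> mu_.
rewrite /Lqpow.
transitivity (\esum_(e in [set: edge G]) ((`|k| `^ q)%:E * edge_Lqpow q (u e) e))%E.
  apply: eq_esum => e _; rewrite /edge_Lqpow -ge0_integralZl//.
  - by apply: eq_integral => x _; rewrite -EFinM /gscale normrM powRM.
  - exact: measurable_edge_open.
  - by apply/measurable_EFinP; exact: measurable_powR_norm.
by rewrite esum_scale ?powR_ge0// => e; exact: edge_Lqpow_ge0.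
Qed.

(** Pointwise [|u + v|] is at most twice the larger of [|u|] and [|v|], hence its power is at most
    the sum of the powers of [|2 u|] and [|2 v|], for every [q > 0]. *)
Lemma LqpowD_lty q u v : 0 < q -> gmeasurable u -> gmeasurable v ->
  (Lqpow q u < +oo)%E -> (Lqpow q v < +oo)%E ->
  (Lqpow q (gadd u v) < +oo)%E.
Proof.
move=> q0 mu_ mv fu fv.
have mO e := measurable_edge_open e.
have H : (Lqpow q (gadd u v) <= Lqpow q (gscale 2 u) + Lqpow q (gscale 2 v))%E.
  rewrite /Lqpow -esumD; last 2 first.
  - by move=> e _; exact: edge_Lqpow_ge0.
  - by move=> e _; exact: edge_Lqpow_ge0.
  apply: le_esum => e _; rewrite -ge0_integralD//.
  - apply: ge0_le_integral.
    + exact: measurable_edge_open.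
    + by move=> x _; rewrite lee_fin powR_ge0.
    + by apply/measurable_EFinP; apply: measurable_powR_norm; apply: measurable_funD.
    + apply: emeasurable_funD; apply/measurable_EFinP; apply: measurable_powR_norm; exact: measurable_funM.
    + move=> x _; rewrite -EFinD lee_fin /gadd /gscale !normrM normr_nat.
      have [uv|vu] := leP `|u e x| `|v e x|.
        apply: ler_wpDl; first exact: powR_ge0.
        apply: ge0_ler_powR; rewrite ?nnegrE ?(ltW q0)//.
        by rewrite (le_trans (ler_normD _ _))// mulr_natl mulr2n lerD2r.
      apply: ler_wpDr; first exact: powR_ge0.
      apply: ge0_ler_powR; rewrite ?nnegrE ?(ltW q0)//.
      by rewrite (le_trans (ler_normD _ _))// mulr_natl mulr2n lerD2l ltW.
  - exact: mO.
  - by apply/measurable_EFinP; apply: measurable_powR_norm; exact: measurable_funM.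
  - by apply/measurable_EFinP; apply: measurable_powR_norm; exact: measurable_funM.
apply: (le_lt_trans H).
rewrite (Lqpow_scale _ _ mu_) (Lqpow_scale _ _ mv).
have c0 := powR_ge0 `|2| q : 0 <= _; move: fu fv => {H}.
move: (`|2| `^ q) c0 (Lqpow q u) (Lqpow q v) (Lqpow_ge0 q u) (Lqpow_ge0 q v).
move=> c c0 a b a0 b0 aoo boo.
by apply: lte_add_pinfty; apply: lte_mul_pinfty.
Qed.

Lemma continuous_gmeasurable u :
  (forall e, {within edge_closed e, continuous (u e)}) -> gmeasurable u.
Proof.
move=> cu e; apply: subspace_continuous_measurable_fun.
  exact: measurable_edge_open.
exact: continuous_subspaceW (@edge_open_closed _ _ e) (cu e).
Qed.

Lemma H1_continuous u e : H1 u -> {within edge_closed e, continuous (u e)}.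
Proof. by move=> [[cu _] _ _ _]; exact: cu. Qed.

Lemma H1_measurable u : H1 u -> gmeasurable u.
Proof. by move=> Hu; apply: continuous_gmeasurable => e; exact: H1_continuous. Qed.

Lemma H1_L2 u : H1 u -> (Lqpow 2 u < +oo)%E.
Proof. by case. Qed.

Lemma H1_D2 u : H1 u -> (Lqpow 2 (gderiv u) < +oo)%E.
Proof. by case. Qed.

Lemma gderivP u e : (exists g, is_weak_derivative e (u e) g) ->
  is_weak_derivative e (u e) (gderiv u e).
Proof. by move=> H; rewrite /gderiv; exact: xgetPex. Qed.

Lemma H1_gderiv u e : H1 u -> is_weak_derivative e (u e) (gderiv u e).
Proof. by move=> [_ wu _ _]; exact: gderivP. Qed.

Lemma gmeasurable_gderiv u : H1 u -> gmeasurable (gderiv u).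
Proof. by move=> Hu e; case: (H1_gderiv e Hu). Qed.

(** [gderiv] is an arbitrary choice; uniqueness almost everywhere allows its norm to be computed
    from whichever weak derivative is at hand. *)
Lemma eq_edge_gderiv u g e : {within edge_closed e, continuous (u e)} ->
  is_weak_derivative e (u e) g ->
  edge_Lqpow 2 (gderiv u e) e = edge_Lqpow 2 g e.
Proof.
move=> cu wg; have wd : is_weak_derivative e (u e) (gderiv u e).
  by apply: gderivP; exists g.
apply: eq_edge_Lqpow; [by case: wd|by case: wg|].
exact: weak_derivative_unique cu wd wg.
Qed.

Lemma Lqpow_gderiv u (g : gfun G) :
  (forall e, {within edge_closed e, continuous (u e)}) ->
  (forall e, is_weak_derivative e (u e) (g e)) ->
  Lqpow 2 (gderiv u) = Lqpow 2 g.
Proof. by move=> cu wg; apply: eq_esum => e _; exact: eq_edge_gderiv. Qed.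

Lemma gadd_weak_derivative u v e : H1 u -> H1 v ->
  is_weak_derivative e (gadd u v e) (gadd (gderiv u) (gderiv v) e).
Proof.
by move=> Hu Hv; apply: is_weak_derivativeD; [exact: H1_continuous..|exact: H1_gderiv|exact: H1_gderiv].
Qed.

Lemma gscale_weak_derivative k u e : H1 u ->
  is_weak_derivative e (gscale k u e) (gscale k (gderiv u) e).
Proof.
by move=> Hu; apply: is_weak_derivativeZ; [exact: H1_continuous|exact: H1_gderiv].
Qed.

Lemma H1_gadd u v : H1 u -> H1 v -> H1 (gadd u v).
Proof.
move=> Hu Hv; have c e : {within edge_closed e, continuous (gadd u v e)}.
  by apply: within_continuousD; exact: H1_continuous.
split.
- split => // h1 h2 h12 nV; case: Hu => -[_ tu] _ _ _; case: Hv => -[_ tv] _ _ _.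
  by rewrite /trace /gadd; congr (_ + _); [exact: tu|exact: tv].
- by move=> e; exists (gadd (gderiv u) (gderiv v) e); exact: gadd_weak_derivative.
- by apply: LqpowD_lty; [|exact: H1_measurable|exact: H1_measurable|exact: H1_L2|exact: H1_L2].
- rewrite (@Lqpow_gderiv _ (gadd (gderiv u) (gderiv v)))//; last first.
    by move=> e; exact: gadd_weak_derivative.
  by apply: LqpowD_lty; [|exact: gmeasurable_gderiv|exact: gmeasurable_gderiv|exact: H1_D2|exact: H1_D2].
Qed.

Lemma Lqpow_gderiv_gscale k u : H1 u ->
  Lqpow 2 (gderiv (gscale k u)) = ((k ^+ 2)%:E * Lqpow 2 (gderiv u))%E.
Proof.
move=> Hu; rewrite (@Lqpow_gderiv _ (gscale k (gderiv u))).
- by rewrite Lqpow_scale ?powR2E//; exact: gmeasurable_gderiv.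
- move=> e; apply: within_continuousM; last exact: H1_continuous.
  by move=> x; exact: cvg_cst.
- by move=> e; exact: gscale_weak_derivative.
Qed.

Lemma H1_gscale k u : H1 u -> H1 (gscale k u).
Proof.
move=> Hu; split.
- split; first by move=> e; apply: within_continuousM; [move=> x; exact: cvg_cst|exact: H1_continuous].
  move=> h1 h2 h12 nV; case: Hu => -[_ tu] _ _ _.
  by rewrite /trace /gscale; congr (_ * _); exact: tu.
- by move=> e; exists (gscale k (gderiv u) e); exact: gscale_weak_derivative.
- rewrite Lqpow_scale; last exact: H1_measurable.
  apply: lte_mul_pinfty; [by rewrite lee_fin powR_ge0|by []|exact: H1_L2].
- rewrite Lqpow_gderiv_gscale//.
  apply: lte_mul_pinfty; [by rewrite lee_fin sqr_ge0|by []|exact: H1_D2].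
Qed.

Lemma H1Z_gadd Z u v : H1Z Z u -> H1Z Z v -> H1Z Z (gadd u v).
Proof.
move=> [Hu Zu] [Hv Zv]; split; first exact: H1_gadd.
by move=> h hZ; have := Zu h hZ; have := Zv h hZ; rewrite /trace /gadd => -> ->; rewrite addr0.
Qed.

Lemma H1Z_gscale Z k u : H1Z Z u -> H1Z Z (gscale k u).
Proof.
move=> [Hu Zu]; split; first exact: H1_gscale.
by move=> h hZ; have := Zu h hZ; rewrite /trace /gscale => ->; rewrite mulr0.
Qed.

(** At each point one of the two parts is 0, and so is its power once [q] is nonzero; by convention
    0 to the power 0 is 1. *)
Lemma Lqpow_posneg q u : q != 0 -> gmeasurable u ->
  Lqpow q u = (Lqpow q (gpos u) + Lqpow q (gneg u))%E.
Proof.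
move=> q0 mu_; rewrite /Lqpow -esumD; last 2 first.
- by move=> e _; exact: edge_Lqpow_ge0.
- by move=> e _; exact: edge_Lqpow_ge0.
apply: eq_esum => e _.
have mp : measurable_fun (edge_open e) (gpos u e).
  by apply: measurable_maxr => //; exact: mu_.
have mn : measurable_fun (edge_open e) (gneg u e).
  by apply: measurable_minr => //; exact: mu_.
rewrite -ge0_integralD.
- apply: eq_integral => x _; rewrite -EFinD /gpos /gneg; congr (_%:E).
  by have [u0|u0] := leP (u e x) 0; rewrite normr0 powR0// ?add0r ?addr0.
- exact: measurable_edge_open.
- by move=> x _; rewrite lee_fin powR_ge0.
- by apply/measurable_EFinP; exact: measurable_powR_norm.
- by move=> x _; rewrite lee_fin powR_ge0.
- by apply/measurable_EFinP; exact: measurable_powR_norm.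
Qed.

Lemma edge_Lqpow2D (g g1 g2 : R -> R) e : measurable_fun (edge_open e) g ->
  measurable_fun (edge_open e) g1 -> measurable_fun (edge_open e) g2 ->
  {ae mu, forall x, edge_open e x -> g x ^+ 2 = g1 x ^+ 2 + g2 x ^+ 2} ->
  edge_Lqpow 2 g e = (edge_Lqpow 2 g1 e + edge_Lqpow 2 g2 e)%E.
Proof.
move=> m m1 m2 H; have mO := measurable_edge_open e.
have mE (k : R -> R) : measurable_fun (edge_open e) k ->
    measurable_fun (edge_open e) (fun x => (k x ^+ 2)%:E).
  by move=> mk; apply/measurable_EFinP; exact: measurable_funX.
have nn (k : R -> R) x : edge_open e x -> (0 <= (k x ^+ 2)%:E)%E.
  by move=> _; rewrite lee_fin sqr_ge0.
have K := @ge0_integralD _ _ _ mu _ mO _ _ (nn g1) (mE _ m1) (nn g2) (mE _ m2).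
rewrite !edge_Lqpow2E; apply: etrans K.
apply: ge0_ae_eq_integral.
- exact: mO.
- exact: mE.
- by apply: emeasurable_funD; exact: mE.
- exact: nn.
- by move=> x _; rewrite -EFinD lee_fin addr_ge0 ?sqr_ge0.
- move: H; apply: filterS; first exact: (ae_filter_ringOfSetsType mu).
  by move=> x H Ox; rewrite H.
Qed.

(** That both parts belong to [H1] is assumed here because [nodal_nehari] contains it. *)
Lemma Lqpow_gderiv_posneg u : H1 u -> H1 (gpos u) -> H1 (gneg u) ->
  Lqpow 2 (gderiv u) = (Lqpow 2 (gderiv (gpos u)) + Lqpow 2 (gderiv (gneg u)))%E.
Proof.
move=> Hu Hp Hn; rewrite /Lqpow -esumD; last 2 first.
- by move=> e _; exact: edge_Lqpow_ge0.
- by move=> e _; exact: edge_Lqpow_ge0.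
apply: eq_esum => e _; apply: edge_Lqpow2D.
- exact: gmeasurable_gderiv.
- exact: gmeasurable_gderiv.
- exact: gmeasurable_gderiv.
- apply: (@weak_derivative_posneg _ _ e (u e)).
  + exact: H1_continuous Hu.
  + exact: H1_continuous Hp.
  + exact: H1_continuous Hn.
  + exact: H1_gderiv Hu.
  + exact: H1_gderiv Hp.
  + exact: H1_gderiv Hn.
Qed.

End graph_functions.

(** * The Nehari set *)

Section nehari.
Variables (R : realType) (G : metric_graph R).
Notation mu := (@lebesgue_measure R).
Implicit Types (e : edge G) (u v w : gfun G) (q k : R).

(** By continuity [|f|] stays above [|f x| / 2] on an interval of positive length. *)
Lemma edge_Lqpow2_gt0 (f : R -> R) e x : (0 < len e)%E ->
  {within edge_closed e, continuous f} -> edge_closed e x -> f x != 0 ->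
  (0 < edge_Lqpow 2 f e)%E.
Proof.
move=> le0 cf ex fx; have mO := measurable_edge_open e.
have mf : measurable_fun (edge_open e) f.
  apply: subspace_continuous_measurable_fun; first exact: mO.
  exact: continuous_subspaceW (@edge_open_closed _ _ e) cf.
have fx0 : 0 < `|f x| by rewrite normr_gt0.
have [d d0 Hd] := within_continuous_dist cf ex (divr_gt0 fx0 (ltr0n R 2)).
(* [x] is an end of this interval, which extends to the left when [x] is the far end of the edge and
   to the right otherwise. *)
have [a [b [ab ea eb Hab]]] : exists a b, [/\ a < b, edge_closed e a,
    edge_closed e b & forall t, a < t < b -> `|t - x| < d].
  have [x0 xl] := ex.
  move: xl; rewrite le_eqVlt => /orP[/eqP xl|xl].
    have x_gt0 : 0 < x by rewrite -lte_fin xl.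
    exists (Num.max 0 (x - d)), x; split => //.
    - by rewrite gt_max x_gt0/=; lra.
    - by split; rewrite ?le_max ?lexx// -xl lee_fin ge_max x0/=; lra.
    - by move=> t /andP[]; rewrite gt_max => /andP[_ ?] ?; rewrite ltr_norml; lra.
  have [c xc cl] : exists2 c, x < c & (c%:E <= len e)%E.
    by case: (len e) xl => [l| |]//= xl; [exists l|exists (x + 1); rewrite ?ltrDl ?leey].
  exists x, (Num.min c (x + d)); split => //.
  - by rewrite lt_min xc/=; lra.
  - split; first by rewrite le_min (le_trans x0 (ltW xc))/=; lra.
    by apply: le_trans cl; rewrite lee_fin ge_min lexx.
  - by move=> t /andP[?]; rewrite lt_min => /andP[_ ?]; rewrite ltr_norml; lra.
have sub := edge_closed_itv_open ea eb; have subC := edge_closed_itv ea eb.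
have mI : measurable (`]a, b[%classic : set R) by exact: measurable_itv.
rewrite edge_Lqpow2E.
pose c : R := (`|f x| / 2) ^+ 2.
have c0 : 0 < c by rewrite exprn_gt0// divr_gt0.
apply: (@lt_le_trans _ _ (\int[mu]_(t in `]a, b[) c%:E)%E).
  rewrite integral_cst//= lebesgue_measure_itv/= lte_fin ab -EFinB -EFinM lte_fin.
  by rewrite mulr_gt0// subr_gt0.
have mE : measurable_fun (edge_open e) (fun t => (f t ^+ 2)%:E).
  by apply/measurable_EFinP; exact: measurable_funX.
apply: (@le_trans _ _ (\int[mu]_(t in `]a, b[) (f t ^+ 2)%:E)%E).
  apply: ge0_le_integral.
  - exact: mI.
  - by move=> t _; rewrite lee_fin ltW.
  - exact: measurable_cst.
  - exact: (measurable_funS mO sub mE).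
  - move=> t; rewrite /= in_itv/= => tab; rewrite lee_fin -(real_normK (num_real (f t))).
    rewrite /c lerXn2r ?nnegrE ?divr_ge0//.
    have := Hd t (subC t _) (Hab t tab); rewrite /= in_itv/=.
    case/andP: tab => /ltW -> /ltW -> /(_ isT).
    have : `|f x| <= `|f t - f x| + `|f t| by rewrite (distrC (f t)) -{1}(subrK (f t) (f x)) ler_normD.
    lra.
apply: ge0_subset_integral.
- exact: mI.
- exact: mO.
- exact: mE.
- by move=> t _; rewrite lee_fin sqr_ge0.
- exact: sub.
Qed.

Lemma Lqpow2_gt0 u : (forall e, 0 < len e)%E -> H1 u -> gnonzero u ->
  (0 < Lqpow 2 u)%E.
Proof.
move=> l0 Hu [e [x [ex ux]]].
apply: lt_le_trans (edge_Lqpow_le 2 u e).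
by apply: (@edge_Lqpow2_gt0 (u e) e x) => //; exact: H1_continuous.
Qed.

Lemma H1_L2_fin u : H1 u -> Lqpow 2 u \is a fin_num.
Proof. by move=> Hu; rewrite ge0_fin_numE ?Lqpow_ge0//; exact: H1_L2. Qed.

Lemma H1_D2_fin u : H1 u -> Lqpow 2 (gderiv u) \is a fin_num.
Proof. by move=> Hu; rewrite ge0_fin_numE ?Lqpow_ge0//; exact: H1_D2. Qed.

Variables (Z : set (vertex G)) (p lambda : R).

(** The quadratic form [Q] of the overview. On [H1] both norms are finite, so [fine] loses
    nothing. *)
Definition energy u : R :=
  fine (Lqpow 2 (gderiv u)) + lambda * fine (Lqpow 2 u).

Lemma energyE u : H1 u ->
  (Lqpow 2 (gderiv u) + lambda%:E * Lqpow 2 u)%E = (energy u)%:E.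
Proof.
(* The norms are abstracted to extended reals so that case analysis leaves an identity in [R]; the
   same device recurs below. *)
have alg (D M : \bar R) : D \is a fin_num -> M \is a fin_num ->
  (D + lambda%:E * M)%E = (fine D + lambda * fine M)%:E by case: D; case: M.
by move=> Hu; exact: alg (H1_D2_fin Hu) (H1_L2_fin Hu).
Qed.

Lemma nehari_energyE u : nehari Z p lambda u -> Lqpow p u = (energy u)%:E.
Proof. by move=> [[Hu _] _ <-]; exact: energyE. Qed.

(** The [L^p] term equals the energy on the Nehari set; for [p > 2] the factor is positive, so
    minimising [J] there is minimising [energy]. *)
Lemma J_nehari u : nehari Z p lambda u ->
  J p lambda u = ((2^-1 - p^-1) * energy u)%:E.
Proof.
have alg (D M P : \bar R) : D \is a fin_num -> M \is a fin_num ->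
    (D + lambda%:E * M)%E = P ->
    ((2^-1)%:E * D + (lambda / 2)%:E * M - (p^-1)%:E * P)%E =
    ((2^-1 - p^-1) * (fine D + lambda * fine M))%:E.
  move=> fD fM <-; case: D fD => // D _; case: M fM => // M _ /=.
  by rewrite -!EFinM -!EFinD; congr (_%:E); move: p^-1 => c; field.
by move=> [[Hu _] _ E]; exact: alg (H1_D2_fin Hu) (H1_L2_fin Hu) E.
Qed.

Lemma energy_gscale k u : H1 u -> energy (gscale k u) = k ^+ 2 * energy u.
Proof.
have alg (D M D' M' : \bar R) : D \is a fin_num -> M \is a fin_num ->
    D' = ((k ^+ 2)%:E * D)%E -> M' = ((k ^+ 2)%:E * M)%E ->
    fine D' + lambda * fine M' = k ^+ 2 * (fine D + lambda * fine M).
  move=> fD fM -> ->; case: D fD => // D _; case: M fM => // M _ /=.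
  by ring.
move=> Hu; apply: (alg _ _ _ _ (H1_D2_fin Hu) (H1_L2_fin Hu)).
  exact: Lqpow_gderiv_gscale.
by rewrite -powR2E; apply: Lqpow_scale; exact: H1_measurable.
Qed.

(** The Rayleigh quotient of [u] is at least [omega Z], hence larger than [- lambda]. Positivity is
    what allows a function to be rescaled onto the Nehari set. *)
Lemma energy_gt0 u : (forall e, 0 < len e)%E -> (- omega Z < lambda%:E)%E ->
  H1Z Z u -> gnonzero u -> 0 < energy u.
Proof.
move=> l0 hl HZu nu; have [Hu _] := HZu.
have H : (omega Z <= Lqpow 2 (gderiv u) / Lqpow 2 u)%E.
  by apply: ereal_inf_lbound; exists u.
have alg (D M w : \bar R) : D \is a fin_num -> M \is a fin_num -> (0 < M)%E ->
    (- w < lambda%:E)%E -> (w <= D / M)%E -> 0 < fine D + lambda * fine M.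
  move=> fD fM; case: D fD => // D _; case: M fM => // M _ /=; rewrite lte_fin => M0 wl.
  rewrite inver gt_eqF// -EFinM => wDM.
  have : ((- lambda)%:E < (D / M)%:E)%E by apply: lt_le_trans wDM; rewrite EFinN lteNl.
  by rewrite lte_fin ltr_pdivlMr//; lra.
exact: alg (H1_D2_fin Hu) (H1_L2_fin Hu) (Lqpow2_gt0 l0 Hu nu) hl H.
Qed.

Lemma J_posneg u : p != 0 -> nodal_nehari Z p lambda u ->
  J p lambda u = (J p lambda (gpos u) + J p lambda (gneg u))%E.
Proof.
move=> p0 [[Hu _] np nn].
have [Hp _] : H1Z Z (gpos u) by case: np.
have [Hn _] : H1Z Z (gneg u) by case: nn.
have mE : gmeasurable u by exact: H1_measurable.
have alg (D M P Dp Mp Pp Dn Mn Pn : \bar R) :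
  Dp \is a fin_num -> Mp \is a fin_num -> Dn \is a fin_num -> Mn \is a fin_num ->
  (Dp + lambda%:E * Mp = Pp)%E -> (Dn + lambda%:E * Mn = Pn)%E ->
  D = (Dp + Dn)%E -> M = (Mp + Mn)%E -> P = (Pp + Pn)%E ->
  ((2^-1)%:E * D + (lambda / 2)%:E * M - (p^-1)%:E * P =
  ((2^-1)%:E * Dp + (lambda / 2)%:E * Mp - (p^-1)%:E * Pp) +
  ((2^-1)%:E * Dn + (lambda / 2)%:E * Mn - (p^-1)%:E * Pn))%E.
  move=> f1 f2 f3 f4 <- <- -> -> ->.
  case: Dp f1 => // Dp _; case: Mp f2 => // Mp _; case: Dn f3 => // Dn _; case: Mn f4 => // Mn _.
  by rewrite /=; congr (_%:E); move: p^-1 => c; field.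
apply: (alg _ _ _ _ _ _ _ _ _ (H1_D2_fin Hp) (H1_L2_fin Hp) (H1_D2_fin Hn) (H1_L2_fin Hn)).
- by case: np.
- by case: nn.
- exact: Lqpow_gderiv_posneg.
- exact: (Lqpow_posneg (lt0r_neq0 (ltr0n R 2)) mE).
- exact: (Lqpow_posneg p0 mE).
Qed.

(** [P] and [Q] stand for the [L^p] power and the energy of a function, and [t], with
    [t^(p - 2) = Q / P], for the factor that puts it on the Nehari set. *)
Lemma rescaling_factor (P Q : R) : 2 < p -> 0 < P -> 0 < Q ->
  exists t : R, [/\ 0 < t, t `^ p * P = t ^+ 2 * Q & Q <= P -> t <= 1].
Proof.
move=> p2 P0 Q0; exists ((Q / P) `^ (p - 2)^-1); set t := _ `^ _.
have QP0 : 0 < Q / P by rewrite divr_gt0.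
have t0 : 0 < t by exact: powR_gt0.
have p20 : p - 2 != 0 by rewrite subr_eq0 gt_eqF.
split => //.
- rewrite (_ : t `^ p = t ^+ 2 * (Q / P)); first by rewrite -mulrA divfK// gt_eqF.
  rewrite -[in LHS](subrKC 2 p) powRD; last by rewrite (gt_eqF t0) implybT.
  rewrite -(powR_mulrn 2 (ltW t0)); congr (_ * _).
  by rewrite /t -powRrM mulVf// powRr1// ltW.
- move=> QP; suff : t <= 1 `^ (p - 2)^-1 by rewrite powR1.
  apply: ge0_ler_powR.
  + by rewrite invr_ge0 subr_ge0 ltW.
  + by rewrite nnegrE ltW.
  + by rewrite nnegrE.
  + by rewrite ler_pdivrMr// mul1r.
Qed.

(** Suppose [energy v < energy w]. The latter is the [L^p] power of [w], hence at most that of [v],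
    so the factor [t] that rescales [v] to the Nehari set is at most 1. Then [t v] has energy at
    most that of [v], below that of [w], against minimality. *)
Lemma energy_min w v : 2 < p -> (forall e, 0 < len e)%E ->
  (- omega Z < lambda%:E)%E -> nehari Z p lambda w ->
  J p lambda w = ereal_inf [set J p lambda v | v in nehari Z p lambda] ->
  H1Z Z v -> (Lqpow p v < +oo)%E ->
  (forall e x, edge_closed e x -> `|w e x| <= `|v e x|) ->
  energy w <= energy v.
Proof.
move=> p2 l0 hl nw Jw HZv Pv wv.
have [HZw [e0 [x0 [ex0 wx0]]] _] := nw; have [Hw _] := HZw; have [Hv _] := HZv.
have nv : gnonzero v.
  exists e0, x0; split => //; rewrite -normr_gt0.
  by apply: lt_le_trans (wv _ _ ex0); rewrite normr_gt0.
have Qv0 := energy_gt0 l0 hl HZv nv.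
have nwnz : gnonzero w by exists e0, x0.
have Qw0 := energy_gt0 l0 hl HZw nwnz.
have p0 : 0 < p by exact: lt_trans p2.
have wvp : (Lqpow p w <= Lqpow p v)%E.
  apply: le_Lqpow => //; [exact: H1_measurable|exact: H1_measurable|].
  by move=> e x /edge_open_closed; exact: wv.
rewrite leNgt; apply/negP => Qvw.
have [P [PE QwP]] : exists P : R, Lqpow p v = P%:E /\ energy w <= P.
  have fP : Lqpow p v \is a fin_num by rewrite ge0_fin_numE// Lqpow_ge0.
  exists (fine (Lqpow p v)); split; first by rewrite fineK.
  by rewrite -lee_fin fineK// -(nehari_energyE nw).
have P0 : 0 < P by exact: lt_le_trans QwP.
have [t [t0 tp t1]] := rescaling_factor p2 P0 Qv0.
have {}t1 : t <= 1 by apply: t1; exact: ltW (lt_le_trans Qvw QwP).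
have ntv : nehari Z p lambda (gscale t v).
  split.
  - exact: H1Z_gscale.
  - have [e [x [ex vx]]] := nv; exists e, x; split => //.
    by rewrite /gscale mulf_neq0// gt_eqF.
  - rewrite energyE; last exact: H1_gscale.
    rewrite energy_gscale// (Lqpow_scale _ _ (H1_measurable Hv)) PE gtr0_norm// -EFinM.
    by congr (_%:E); rewrite tp.
have : (J p lambda w <= J p lambda (gscale t v))%E.
  by rewrite Jw; apply: ereal_inf_lbound; exists (gscale t v).
rewrite (J_nehari nw) (J_nehari ntv) lee_fin.
have c0 : 0 < 2^-1 - p^-1 by rewrite subr_gt0 ltf_pV2 ?posrE.
rewrite ler_pM2l// energy_gscale// leNgt => /negP; apply.
apply: le_lt_trans Qvw; rewrite ler_piMl ?(ltW Qv0)//.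
by rewrite expr_le1// ltW.
Qed.

End nehari.

(** * First variation of the energy at a nonnegative ground state *)

Section first_variation.
Variables (R : realType) (G : metric_graph R).
Notation mu := (@lebesgue_measure R).
Implicit Types (e : edge G) (u v w phi psi : gfun G) (q k s : R).

Lemma esum_setT_fin (T : choiceType) (F : set T) (a : T -> \bar R) :
  finite_set F -> (forall i, 0 <= a i)%E ->
  (\esum_(i in [set: T]) a i =
    \sum_(i <- fset_set F) a i + \esum_(i in ~` F) a i)%E.
Proof.
move=> fF a0; rewrite (esumID F)//; congr (_ + _)%E; last by rewrite setTI.
by rewrite setTI esum_fset// fsbig_finite.
Qed.

Lemma esum_fin_support_lty (T : choiceType) (F : set T) (a : T -> \bar R) :
  finite_set F -> (forall i, 0 <= a i)%E -> (forall i, ~ F i -> a i = 0%E) ->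
  (forall i, a i < +oo)%E -> (\esum_(i in [set: T]) a i < +oo)%E.
Proof.
move=> fF a0 aF aoo; rewrite (esum_setT_fin fF a0) (esum1 (D := ~` F))// adde0.
by elim/big_ind : _ => //; exact: lte_add_pinfty.
Qed.

(** The common tail outside [F] is finite and cancels, so a perturbation on finitely many edges
    changes a norm by a finite sum of reals. *)
Lemma esum_fin_difference (T : choiceType) (F : set T) (a b : T -> \bar R) :
  finite_set F -> (forall i, 0 <= a i)%E -> (forall i, 0 <= b i)%E ->
  (forall i, ~ F i -> a i = b i) ->
  (\esum_(i in [set: T]) a i < +oo)%E -> (\esum_(i in [set: T]) b i < +oo)%E ->
  fine (\esum_(i in [set: T]) a i) - fine (\esum_(i in [set: T]) b i) =
  \sum_(i <- fset_set F) (fine (a i) - fine (b i)).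
Proof.
move=> fF a0 b0 ab aoo boo.
have fin (c : T -> \bar R) : (forall i, 0 <= c i)%E ->
    (\esum_(i in [set: T]) c i < +oo)%E ->
    fine (\esum_(i in [set: T]) c i) =
    \sum_(i <- fset_set F) fine (c i) + fine (\esum_(i in ~` F) c i).
  move=> c0; rewrite (esum_setT_fin fF c0) => coo.
  have s0 : (0 <= \sum_(i <- fset_set F) c i)%E by exact: sume_ge0.
  have e0 : (0 <= \esum_(i in ~` F) c i)%E by exact: esum_ge0.
  have f1 : (\esum_(i in ~` F) c i)%E \is a fin_num.
    by rewrite ge0_fin_numE//; apply: le_lt_trans coo; exact: leeDr.
  have f2 : (\sum_(i <- fset_set F) c i)%E \is a fin_num.
    by rewrite ge0_fin_numE//; apply: le_lt_trans coo; exact: leeDl.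
  rewrite fineD//; congr (_ + _).
  have fi i : c i \is a fin_num.
    rewrite ge0_fin_numE// -(esum_set1 (c0 i)); apply: le_lt_trans coo.
    rewrite -(esum_setT_fin fF c0); apply: esum_ge; exists [set i].
      by split => //; exact: finite_set1.
    by rewrite esum_set1// fsbig_set1.
  rewrite (eq_bigr (fun i => (fine (c i))%:E)) ?sumEFin// => i _.
  by rewrite fineK.
rewrite (fin a)// (fin b)// sumrB.
rewrite (eq_esum (b := b)) => [|i /ab//].
by rewrite opprD addrACA subrr addr0.
Qed.

Lemma edge_sqr_expand (f h : R -> R) s e : measurable_fun (edge_open e) f ->
  measurable_fun (edge_open e) h ->
  (edge_Lqpow 2 f e < +oo)%E -> (edge_Lqpow 2 h e < +oo)%E ->
  fine (edge_Lqpow 2 (fun x => f x + s * h x) e) - fine (edge_Lqpow 2 f e) =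
  2 * s * \int[mu]_(x in edge_open e) (f x * h x) +
  s ^+ 2 * fine (edge_Lqpow 2 h e).
Proof.
move=> mf mh; rewrite !edge_Lqpow2E => f2 h2; have mO := measurable_edge_open e.
have i1 := integrable_sqr mf f2; have i2 := integrable_sqr mh h2.
have i3 := integrable_mul_sqr mf mh f2 h2.
rewrite -!/(Rintegral _ _ _).
have -> : \int[mu]_(x in edge_open e) ((f x + s * h x) ^+ 2) =
    \int[mu]_(x in edge_open e) (f x ^+ 2 + (2 * s * (f x * h x) + s ^+ 2 * h x ^+ 2)).
  by apply: eq_Rintegral => x _; ring.
rewrite RintegralD//; last first.
  by apply: integrable_addr => //; exact: integrable_scaler.
rewrite RintegralD//; [|exact: integrable_scaler..].
by rewrite !RintegralZl// addrC addKr.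
Qed.

(** An explicit [psi] replaces [gderiv phi], which off [F] is known to vanish only almost
    everywhere; with formulas for [psi] the pairings can later be computed. *)
Lemma energy_perturbation lambda (F : set (edge G)) w phi psi s :
  finite_set F -> H1 w -> H1 phi ->
  (forall e, is_weak_derivative e (phi e) (psi e)) ->
  (forall e x, ~ F e -> phi e x = 0) -> (forall e x, ~ F e -> psi e x = 0) ->
  energy lambda (gadd w (gscale s phi)) - energy lambda w =
  2 * s * (\sum_(e <- fset_set F)
     (\int[mu]_(x in edge_open e) (gderiv w e x * psi e x) +
      lambda * \int[mu]_(x in edge_open e) (w e x * phi e x))) +
  s ^+ 2 * (\sum_(e <- fset_set F)
     (fine (edge_Lqpow 2 (psi e) e) + lambda * fine (edge_Lqpow 2 (phi e) e))).
Proof.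
move=> fF Hw Hphi wpsi phi0 psi0.
have Hs : H1 (gscale s phi) by exact: H1_gscale.
have Hv : H1 (gadd w (gscale s phi)) by exact: H1_gadd.
have Lge0 (f : gfun G) e : (0 <= edge_Lqpow 2 (f e) e)%E by exact: edge_Lqpow_ge0.
have M : fine (Lqpow 2 (gadd w (gscale s phi))) - fine (Lqpow 2 w) =
    \sum_(e <- fset_set F) (2 * s * \int[mu]_(x in edge_open e) (w e x * phi e x) +
      s ^+ 2 * fine (edge_Lqpow 2 (phi e) e)).
  rewrite (esum_fin_difference fF (Lge0 _) (Lge0 _)).
  - apply: eq_bigr => e _; apply: edge_sqr_expand.
    + exact: H1_measurable.
    + exact: H1_measurable.
    + by apply: le_lt_trans (edge_Lqpow_le 2 w e) _; exact: H1_L2.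
    + by apply: le_lt_trans (edge_Lqpow_le 2 phi e) _; exact: H1_L2.
  - move=> e nF; apply: eq_integral => x _.
    by rewrite /gadd /gscale phi0// mulr0 addr0.
  - exact: H1_L2.
  - exact: H1_L2.
have D : fine (Lqpow 2 (gderiv (gadd w (gscale s phi)))) - fine (Lqpow 2 (gderiv w)) =
    \sum_(e <- fset_set F) (2 * s * \int[mu]_(x in edge_open e) (gderiv w e x * psi e x) +
      s ^+ 2 * fine (edge_Lqpow 2 (psi e) e)).
  have wv e : is_weak_derivative e (gadd w (gscale s phi) e) (gadd (gderiv w) (gscale s psi) e).
    apply: is_weak_derivativeD.
    - exact: H1_continuous.
    - exact: H1_continuous.
    - exact: H1_gderiv.
    - apply: is_weak_derivativeZ; first exact: H1_continuous.
      exact: wpsi.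
  have cv e : {within edge_closed e, continuous (gadd w (gscale s phi) e)}.
    exact: H1_continuous.
  have E1 := Lqpow_gderiv cv wv.
  rewrite E1 (esum_fin_difference fF (Lge0 _) (Lge0 _)).
  - apply: eq_bigr => e _; apply: edge_sqr_expand.
    + exact: gmeasurable_gderiv.
    + by case: (wpsi e).
    + by apply: le_lt_trans (edge_Lqpow_le 2 (gderiv w) e) _; exact: H1_D2.
    + by rewrite edge_Lqpow2E; case: (wpsi e).
  - move=> e nF; apply: eq_integral => x _.
    by rewrite /gadd /gscale (psi0 e x nF) mulr0 addr0.
  - have := H1_D2 Hv; rewrite E1; exact.
  - exact: H1_D2.
have alg (l : seq (edge G)) (a b c d : edge G -> R) (D1 M1 D0 M0 : R) :
    M1 - M0 = \sum_(e <- l) (2 * s * b e + s ^+ 2 * d e) ->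
    D1 - D0 = \sum_(e <- l) (2 * s * a e + s ^+ 2 * c e) ->
    D1 + lambda * M1 - (D0 + lambda * M0) =
    2 * s * (\sum_(e <- l) (a e + lambda * b e)) +
    s ^+ 2 * (\sum_(e <- l) (c e + lambda * d e)).
  move=> HM HD.
  have -> : D1 + lambda * M1 - (D0 + lambda * M0) = (D1 - D0) + lambda * (M1 - M0) by ring.
  rewrite HM HD !mulr_sumr -!big_split/=.
  by apply: eq_bigr => e _; ring.
exact: alg M D.
Qed.

(* For [v = w + s phi] with [s > 0] the [L^p] norm does not decrease, so the
   energy cannot decrease either; letting [s] go to 0 kills the term [s^2]. *)
Lemma first_variation_ge0 (Z : set (vertex G)) (p lambda : R) (F : set (edge G)) w phi psi :
  2 < p -> (forall e, 0 < len e)%E -> (- omega Z < lambda%:E)%E ->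
  nehari Z p lambda w ->
  J p lambda w = ereal_inf [set J p lambda v | v in nehari Z p lambda] ->
  (forall e x, edge_closed e x -> 0 <= w e x) ->
  finite_set F -> H1Z Z phi -> (Lqpow p phi < +oo)%E ->
  (forall e x, 0 <= phi e x) ->
  (forall e, is_weak_derivative e (phi e) (psi e)) ->
  (forall e x, ~ F e -> phi e x = 0) -> (forall e x, ~ F e -> psi e x = 0) ->
  0 <= \sum_(e <- fset_set F)
     (\int[mu]_(x in edge_open e) (gderiv w e x * psi e x) +
      lambda * \int[mu]_(x in edge_open e) (w e x * phi e x)).
Proof.
move=> p2 l0 hl nw Jw w0 fF HZphi phip phi_ge0 wpsi phi0 psi0.
have [HZw _ _] := nw; have [Hw _] := HZw; have [Hphi _] := HZphi.
set B := \sum_(e <- _) _.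
pose C := \sum_(e <- fset_set F)
     (fine (edge_Lqpow 2 (psi e) e) + lambda * fine (edge_Lqpow 2 (phi e) e)).
have p0 : 0 < p by exact: lt_trans p2.
have H s : 0 < s -> 0 <= 2 * s * B + s ^+ 2 * C.
  move=> s0; rewrite -(energy_perturbation lambda s fF Hw Hphi wpsi phi0 psi0) subr_ge0.
  apply: (energy_min p2 l0 hl nw Jw).
  - by apply: H1Z_gadd; [exact: HZw|exact: H1Z_gscale].
  - apply: LqpowD_lty; first exact: p0.
    + exact: H1_measurable.
    + by apply: H1_measurable; exact: H1_gscale.
    + have E := nehari_energyE nw; by rewrite E ltry.
    + have E := Lqpow_scale p s (H1_measurable Hphi).
      by rewrite E; apply: lte_mul_pinfty; rewrite ?lee_fin ?powR_ge0.
  - move=> e x ex; have := w0 e x ex => wex.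
    rewrite /gadd /gscale !ger0_norm//.
      by rewrite lerDl mulr_ge0// ltW.
    by rewrite addr_ge0// mulr_ge0// ltW.
clearbody B C; move: H => {}H.
rewrite leNgt; apply/negP => B0.
have [C0|C0] := leP C 0.
  by have := H 1 ltr01; lra.
(* The minimum point of [2 s B + s^2 C], at which the value [- B^2 / C] is negative. *)
have s0 : 0 < - B / C by rewrite divr_gt0// oppr_gt0.
have := H _ s0; suff -> : 2 * (- B / C) * B + (- B / C) ^+ 2 * C = - (B ^+ 2 / C).
  rewrite oppr_ge0 leNgt divr_gt0//.
  by rewrite -sqrrN exprn_gt0// oppr_gt0.
by field; rewrite gt_eqF.
Qed.

End first_variation.

(** * Strong maximum principle *)

Section tent_sums.
Variables (R : realType) (G : metric_graph R).
Notation mu := (@lebesgue_measure R).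
Implicit Types (e : edge G) (w : gfun G) (b : bool) (q r x : R).

(** At most one tent per edge, present where [on] holds. A loop requires a tent at either end, hence
    the sum of two such families in [tents]. *)
Definition gtent (on : edge G -> bool) (c : edge G -> R) r : gfun G :=
  fun e x => (on e)%:R * tent (c e) r x.

Definition gtent' (on : edge G -> bool) (c : edge G -> R) r : gfun G :=
  fun e x => (on e)%:R * tent' (c e) r x.

Lemma gtent_weak_derivative on c r e : 0 < r ->
  is_weak_derivative e (gtent on c r e) (gtent' on c r e).
Proof.
move=> r0; apply: is_weak_derivativeZ; last exact: is_weak_derivative_tent.
by apply: continuous_subspaceT; exact: continuous_tent.
Qed.

Lemma continuous_gtent on c r e : continuous (gtent on c r e).
Proof.
by move=> x; apply: cvgM; [exact: cvg_cst|exact: continuous_tent].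
Qed.

Lemma edge_Lqpow0 q e : q != 0 -> edge_Lqpow q (cst 0 : R -> R) e = 0%E.
Proof.
move=> q0; rewrite /edge_Lqpow; under eq_integral do rewrite /= normr0 powR0//.
by rewrite integral0.
Qed.

Lemma edge_Lqpow_tent_lty q c r e : 0 < q -> 0 < r ->
  (edge_Lqpow q (tent c r) e < +oo)%E.
Proof.
move=> q0 r0.
have mI : measurable (`[c - r, c + r]%classic : set R) by exact: measurable_itv.
have mO := measurable_edge_open e.
have i1 : mu.-integrable `[c - r, c + r] (EFin \o (fun=> 1 : R)).
  by apply: itv_integrable; apply: continuous_subspaceT => x; exact: cvg_cst.
have mt : measurable_fun setT (fun x => `|tent c r x| `^ q).
  apply: (measurableT_comp (measurable_powR q)); apply: measurableT_comp => //.
  by apply: continuous_measurable_fun; exact: continuous_tent.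
have i2 : mu.-integrable `[c - r, c + r] (EFin \o (fun x => `|tent c r x| `^ q)).
  apply: (integrable_le mI _ _ i1); first exact: measurable_funTS.
  move=> x _; rewrite ger0_norm ?powR_ge0//.
  have /andP[t0 t1] := tent_bound c x r0.
  suff : `|tent c r x| `^ q <= 1 `^ q by rewrite powR1.
  by apply: ge0_ler_powR; rewrite ?nnegrE ?(ltW q0)// ger0_norm.
have i3 : mu.-integrable setT (EFin \o (fun x => `|tent c r x| `^ q)).
  apply: (integrable_support measurableT mI _ _ i2) => // x _ /= nx.
  rewrite tent_out ?normr0 ?powR0 ?gt_eqF// leNgt; apply/negP => H; apply: nx.
  by move: H; rewrite in_itv/= ltr_norml; lra.
have iO : mu.-integrable (edge_open e) (EFin \o (fun x => `|tent c r x| `^ q)).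
  exact: (@integrableS _ _ _ mu setT (edge_open e) _ measurableT mO (@subsetT _ _) i3).
exact: (@integrable_lty _ _ _ mu _ mO _ iO).
Qed.

Lemma Lqpow_gtent_lty q (F : set (edge G)) (on : edge G -> bool) c r : 0 < q -> 0 < r ->
  finite_set F -> (forall e, on e -> F e) -> (Lqpow q (gtent on c r) < +oo)%E.
Proof.
move=> q0 r0 fF onF.
have E0 e : on e = false -> edge_Lqpow q (gtent on c r e) e = 0%E.
  move=> e0; rewrite (_ : gtent on c r e = cst 0); first exact: (edge_Lqpow0 e (lt0r_neq0 q0)).
  by apply/funext => x; rewrite /gtent e0 mul0r.
apply: (esum_fin_support_lty fF (a := fun e => edge_Lqpow q (gtent on c r e) e)).
- by move=> e; exact: edge_Lqpow_ge0.
- by move=> e nF; apply: E0; apply/negP => /onF.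
- move=> e; case one : (on e); last by rewrite E0.
  rewrite (_ : gtent on c r e = tent (c e) r); first exact: edge_Lqpow_tent_lty.
  by apply/funext => x; rewrite /gtent one mul1r.
Qed.

Lemma Lqpow_gtent'_lty (F : set (edge G)) (on : edge G -> bool) c r : 0 < r ->
  finite_set F -> (forall e, on e -> F e) -> (Lqpow 2 (gtent' on c r) < +oo)%E.
Proof.
move=> r0 fF onF.
have E0 e : on e = false -> edge_Lqpow 2 (gtent' on c r e) e = 0%E.
  move=> e0; rewrite (_ : gtent' on c r e = cst 0); first exact: (edge_Lqpow0 e (lt0r_neq0 (ltr0n R 2))).
  by apply/funext => x; rewrite /gtent' e0 mul0r.
apply: (esum_fin_support_lty fF (a := fun e => edge_Lqpow 2 (gtent' on c r e) e)).
- by move=> e; exact: edge_Lqpow_ge0.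
- by move=> e nF; apply: E0; apply/negP => /onF.
- move=> e; case one : (on e); last by rewrite E0.
  rewrite (_ : gtent' on c r e = tent' (c e) r).
    by rewrite edge_Lqpow2E; exact: tent'_sqr_lty.
  by apply/funext => x; rewrite /gtent' one mul1r.
Qed.

(** The tent is at most 1 and lives on an interval of length [2 * r]. This factor [r], against the
    [1 / r] of [tent'_pairing], produces the [r^2]. *)
Lemma integral_tent_le (f : R -> R) e c r M : 0 < r -> 0 <= M ->
  measurable_fun (edge_open e) f ->
  (edge_Lqpow 2 f e < +oo)%E ->
  (forall x, edge_open e x -> `|x - c| <= r -> 0 <= f x <= M) ->
  0 <= \int[mu]_(x in edge_open e) (f x * tent c r x) <= 2 * r * M.
Proof.
move=> r0 M0 mf f2 fM; have mO := measurable_edge_open e.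
have mt : measurable_fun (edge_open e) (tent c r).
  by apply: measurable_funTS; apply: continuous_measurable_fun; exact: continuous_tent.
have tout x : ~ x \in `[c - r, c + r] -> tent c r x = 0.
  move=> nx; rewrite tent_out// leNgt; apply/negP => H; apply: nx.
  by move: H; rewrite in_itv/= ltr_norml; lra.
have t2 := @edge_Lqpow_tent_lty 2 c r e (ltr0n R 2) r0.
have i1 : mu.-integrable (edge_open e) (EFin \o (fun x => f x * tent c r x)).
  apply: (integrable_mul_sqr mf mt); rewrite -edge_Lqpow2E; [exact: f2|exact: t2].
pose k x : R := M * \1_(`[c - r, c + r]%classic) x.
have ik : mu.-integrable setT (EFin \o k).
  apply: integrable_scaler => //.
  have := @integrable_indic_itv R (c - r) (c + r) true false.
  exact.
have ikO : mu.-integrable (edge_open e) (EFin \o k).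
  exact: (@integrableS _ _ _ mu setT (edge_open e) _ measurableT mO (@subsetT _ _) ik).
have near x : x \in `[c - r, c + r] -> `|x - c| <= r.
  by rewrite in_itv/= ler_norml; lra.
have pos x : edge_open e x -> 0 <= f x * tent c r x.
  move=> Ox; have [xI|/negP xI] := boolP (x \in `[c - r, c + r]); last by rewrite tout// mulr0.
  have /andP[t0 _] := tent_bound c x r0.
  by have /andP[f0 _] := fM x Ox (near x xI); rewrite mulr_ge0.
apply/andP; split; first exact: Rintegral_ge0.
apply: (@le_trans _ _ (\int[mu]_(x in edge_open e) k x)).
  apply: le_Rintegral => // x Ox; rewrite /k indicE mem_setE.
  have [xI|/negP xI] := boolP (x \in `[c - r, c + r]); last by rewrite tout// mulr0 mulr0.
  have /andP[t0 t1] := tent_bound c x r0.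
  have /andP[f0 f1] := fM x Ox (near x xI); rewrite mulr1.
  by rewrite (le_trans _ f1)// ler_piMr.
have E : \int[mu]_x k x = 2 * r * M.
  rewrite (@Rintegral_support _ _ `[c - r, c + r])//.
    have -> : \int[mu]_(x in `[c - r, c + r]) k x = \int[mu]_(x in `[c - r, c + r]) (M : R).
      by apply: eq_Rintegral => x; rewrite /k indicE => ->; rewrite mulr1.
    rewrite Rintegral_cst//= lebesgue_measure_itv/= lte_fin ifT; last by lra.
    rewrite -EFinB /=; ring.
  by move=> x _ nx; rewrite /k indicE memNset// mulr0.
rewrite -E; apply: fine_le.
- exact: (@integrable_fin_num _ _ _ mu _ mO _ ikO).
- exact: (@integrable_fin_num _ _ _ mu _ measurableT _ ik).
- apply: ge0_subset_integral => //.
    by apply: (measurable_int mu).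
  by move=> x _; rewrite lee_fin mulr_ge0.
Qed.

End tent_sums.

(** * Vanishing of a ground state near its zeros *)

Section vanishing.
Variables (R : realType) (G : metric_graph R).
Notation mu := (@lebesgue_measure R).
Implicit Types (e : edge G) (w : gfun G) (b : bool) (r x : R).

Definition nonneg_ground_state (Z : set (vertex G)) (p lambda : R) w : Prop :=
  [/\ nehari Z p lambda w,
      J p lambda w = ereal_inf [set J p lambda v | v in nehari Z p lambda] &
      forall e x, edge_closed e x -> 0 <= w e x].

(* At a vertex [b] tells apart the two ends of the edge [e]; at an interior
   point only one value of [b] is used. *)
Definition tents (on : edge G -> bool -> bool) (ctr : edge G -> bool -> R) r : gfun G :=
  gadd (gtent (on^~ true) (ctr^~ true) r) (gtent (on^~ false) (ctr^~ false) r).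

Definition tents' (on : edge G -> bool -> bool) (ctr : edge G -> bool -> R) r : gfun G :=
  gadd (gtent' (on^~ true) (ctr^~ true) r) (gtent' (on^~ false) (ctr^~ false) r).

(** On each side the tent either stays inside the edge or is cut off entirely, its centre being that
    end of the edge; it is never cut partway down a slope. *)
Definition tent_fits e (c r : R) : Prop :=
  [/\ edge_closed e c, c = 0 \/ edge_closed e (c - r) &
      len e = c%:E \/ edge_closed e (c + r)].

Lemma tent_fits_le e (c r s : R) : tent_fits e c s -> 0 < r <= s -> tent_fits e c r.
Proof.
move=> [ec H1 H2] /andP[r0 rs]; split => //.
  case: H1 => [|es]; [by left|right].
  by apply: (edge_closed_itv es ec); rewrite /= in_itv/=; lra.
case: H2 => [|es]; [by left|right].
by apply: (edge_closed_itv ec es); rewrite /= in_itv/=; lra.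
Qed.

Section halving.
Variables (Z : set (vertex G)) (p lambda : R) (w : gfun G) (F : set (edge G)).
Variables (on : edge G -> bool -> bool) (ctr : edge G -> bool -> R) (r0 : R).
Hypotheses (p2 : 2 < p) (l0 : forall e, (0 < len e)%E).
Hypotheses (hl : (- omega Z < lambda%:E)%E).
Hypothesis gs : nonneg_ground_state Z p lambda w.
Hypotheses (fF : finite_set F) (onF : forall e b, on e b -> F e).
Hypothesis fits : forall e b, on e b -> tent_fits e (ctr e b) r0.
Hypothesis w_ctr : forall e b, on e b -> w e (ctr e b) = 0.
(** Continuity at the vertices and the condition on [Z] in one statement. It covers both uses: [tau]
    is 0 for a single tent at an interior zero, and the indicator of [v] for the tents on all
    half-edges at a vertex [v]. *)
Hypothesis traces : forall r, 0 < r <= r0 -> exists2 tau : vertex G -> R,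
  (forall v, Z v -> tau v = 0) &
  (forall h, ~ Vinf (endpoint h) -> trace (tents on ctr r) h = tau (endpoint h)).
Hypothesis ZVinf : forall v, Z v -> ~ Vinf v.

Lemma tents_H1Z r : 0 < r <= r0 -> H1Z Z (tents on ctr r).
Proof.
move=> rr0; have [tau tauZ tauE] := traces rr0; have /andP[r_gt0 _] := rr0.
have c e : continuous (tents on ctr r e).
  by move=> x; apply: cvgD; exact: continuous_gtent.
have wd e : is_weak_derivative e (tents on ctr r e) (tents' on ctr r e).
  by apply: is_weak_derivativeD; first [exact: gtent_weak_derivative
     |apply: continuous_subspaceT; exact: continuous_gtent].
split; last first.
  by move=> h hZ; rewrite tauE; [exact: tauZ|exact: ZVinf].
have mt b : gmeasurable (gtent (on^~ b) (ctr^~ b) r).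
  by apply: continuous_gmeasurable => e; apply: continuous_subspaceT; exact: continuous_gtent.
have mt' b : gmeasurable (gtent' (on^~ b) (ctr^~ b) r).
  by move=> e; case: (gtent_weak_derivative (on^~ b) (ctr^~ b) e r_gt0).
split.
- split; first by move=> e; exact: continuous_subspaceT.
  by move=> h1 h2 h12 nV; rewrite !tauE// -?h12// h12.
- by move=> e; exists (tents' on ctr r e).
- apply: LqpowD_lty; [by []|exact: mt|exact: mt| |].
    by apply: (@Lqpow_gtent_lty _ _ _ F) => // e; exact: onF.
  by apply: (@Lqpow_gtent_lty _ _ _ F) => // e; exact: onF.
- have ct e : {within edge_closed e, continuous (tents on ctr r e)}.
    exact: continuous_subspaceT.
  rewrite (Lqpow_gderiv ct wd).
  apply: LqpowD_lty; [by []|exact: mt'|exact: mt'| |].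
    by apply: (@Lqpow_gtent'_lty _ _ F) => // e; exact: onF.
  by apply: (@Lqpow_gtent'_lty _ _ F) => // e; exact: onF.
Qed.

Let S e r b : R := (on e b)%:R *
  (extend0 e (w e) (ctr e b - r) + extend0 e (w e) (ctr e b + r)).

Lemma extend0_ge0 e x : 0 <= extend0 e (w e) x.
Proof. by rewrite /extend0; case: asboolP => // ex; have [_ _ w0] := gs; exact: w0. Qed.

Let S_ge0 e r b : 0 <= S e r b.
Proof. by rewrite /S mulr_ge0// addr_ge0 ?extend0_ge0. Qed.

Let w_H1 : H1 w. Proof. by have [[[]]] := gs. Qed.

Lemma integral_gderiv_tents' e r : 0 < r <= r0 ->
  \int[mu]_(x in edge_open e) (gderiv w e x * tents' on ctr r e x) =
  - (r^-1 * (S e r true + S e r false)).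
Proof.
move=> rr0; have /andP[r_gt0 _] := rr0; have mO := measurable_edge_open e.
have Hw := w_H1; have wd := H1_gderiv e Hw; have [mg g2 _] := wd.
have i b : mu.-integrable (edge_open e)
    (EFin \o (fun x => gderiv w e x * tent' (ctr e b) r x)).
  apply: (integrable_mul_sqr mg _ g2 (tent'_sqr_lty e (ctr e b) r_gt0)).
  by apply: measurable_funTS; exact: measurable_tent'.
have P b : (on e b)%:R * \int[mu]_(x in edge_open e) (gderiv w e x * tent' (ctr e b) r x)
    = - (r^-1 * S e r b).
  rewrite /S; case one : (on e b); last by rewrite !mul0r mulr0 oppr0.
  have [ec f1 f2] := tent_fits_le (fits one) rr0.
  have cw : {within edge_closed e, continuous (w e)} by exact: H1_continuous.
  by rewrite !mul1r (tent'_pairing cw wd r_gt0 ec (w_ctr one) f1 f2).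
have -> : \int[mu]_(x in edge_open e) (gderiv w e x * tents' on ctr r e x) =
    \int[mu]_(x in edge_open e)
      ((on e true)%:R * (gderiv w e x * tent' (ctr e true) r x) +
       (on e false)%:R * (gderiv w e x * tent' (ctr e false) r x)).
  by apply: eq_Rintegral => x _; rewrite /tents' /gadd /gtent'; ring.
rewrite RintegralD//; [|exact: integrable_scaler|exact: integrable_scaler].
by rewrite !RintegralZl// !P mulrDr opprD.
Qed.

Lemma integral_tents_le e r M : 0 < r <= r0 -> 0 <= M ->
  (forall e b x, on e b -> edge_closed e x -> `|x - ctr e b| <= r0 -> w e x <= M) ->
  0 <= \int[mu]_(x in edge_open e) (w e x * tents on ctr r e x) <= 4 * r * M.
Proof.
move=> rr0 M0 wM; have /andP[r_gt0 r_le] := rr0; have mO := measurable_edge_open e.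
have Hw := w_H1.
have mw : measurable_fun (edge_open e) (w e) by exact: H1_measurable.
have w2 : (edge_Lqpow 2 (w e) e < +oo)%E.
  by apply: le_lt_trans (edge_Lqpow_le 2 w e) _; exact: H1_L2.
have i b : mu.-integrable (edge_open e)
    (EFin \o (fun x => w e x * tent (ctr e b) r x)).
  apply: (integrable_mul_sqr mw).
  - by apply: measurable_funTS; apply: continuous_measurable_fun; exact: continuous_tent.
  - by rewrite -edge_Lqpow2E; exact: w2.
  - by rewrite -edge_Lqpow2E; exact: edge_Lqpow_tent_lty.
have P b : 0 <= (on e b)%:R * \int[mu]_(x in edge_open e) (w e x * tent (ctr e b) r x)
    <= 2 * r * M.
  case one : (on e b); last by rewrite mul0r lexx !mulr_ge0// ltW.
  rewrite mul1r; apply: integral_tent_le => // x Ox xc; apply/andP; split.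
    by have [_ _ w0] := gs; apply: w0; exact: edge_open_closed.
  by apply: wM one _ _; [exact: edge_open_closed|exact: le_trans r_le].
have -> : \int[mu]_(x in edge_open e) (w e x * tents on ctr r e x) =
    \int[mu]_(x in edge_open e)
      ((on e true)%:R * (w e x * tent (ctr e true) r x) +
       (on e false)%:R * (w e x * tent (ctr e false) r x)).
  by apply: eq_Rintegral => x _; rewrite /tents /gadd /gtent; ring.
rewrite RintegralD//; [|exact: integrable_scaler|exact: integrable_scaler].
rewrite !RintegralZl//.
have alg (A B C : R) : 0 <= A <= C -> 0 <= B <= C -> 0 <= A + B <= C + C by lra.
have -> : 4 * r * M = 2 * r * M + 2 * r * M by ring.
exact: alg.
Qed.

(** In the nonnegative first variation each edge of [F] contributes [- 1 / r] times the values of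
    [w] at distance [r] from its centres, plus at most [4 * |lambda| * r * M]. The values being
    nonnegative, those around one centre are bounded by the total. *)
Lemma halving M r : 0 < r <= r0 -> 0 <= M ->
  (forall e b x, on e b -> edge_closed e x -> `|x - ctr e b| <= r0 -> w e x <= M) ->
  forall e b, on e b ->
  extend0 e (w e) (ctr e b - r) + extend0 e (w e) (ctr e b + r) <=
    4 * `|lambda| * (size (fset_set F))%:R * r ^+ 2 * M.
Proof.
move=> rr0 M0 wM e b eb; have /andP[r_gt0 r_le] := rr0.
have [nw Jw w0] := gs.
have HZphi := tents_H1Z rr0.
have tents_ge0 e' x : 0 <= tents on ctr r e' x.
  rewrite /tents /gadd /gtent; apply: addr_ge0; apply: mulr_ge0 => //.
    by have /andP[] := tent_bound (ctr e' true) x r_gt0.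
  by have /andP[] := tent_bound (ctr e' false) x r_gt0.
have wd e' : is_weak_derivative e' (tents on ctr r e') (tents' on ctr r e').
  by apply: is_weak_derivativeD; first [exact: gtent_weak_derivative
     |apply: continuous_subspaceT; exact: continuous_gtent].
have off e' b' : ~ F e' -> on e' b' = false by move=> nF; apply/negP => /onF.
have z1 e' x : ~ F e' -> tents on ctr r e' x = 0.
  by move=> nF; rewrite /tents /gadd /gtent !off// !mul0r addr0.
have z2 e' x : ~ F e' -> tents' on ctr r e' x = 0.
  by move=> nF; rewrite /tents' /gadd /gtent' !off// !mul0r addr0.
have p0 : 0 < p by exact: lt_trans p2.
have Lp : (Lqpow p (tents on ctr r) < +oo)%E.
  apply: LqpowD_lty; first exact: p0.
  - by apply: continuous_gmeasurable => e'; apply: continuous_subspaceT; exact: continuous_gtent.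
  - by apply: continuous_gmeasurable => e'; apply: continuous_subspaceT; exact: continuous_gtent.
  - by apply: (@Lqpow_gtent_lty _ _ _ F) => // e'; exact: onF.
  - by apply: (@Lqpow_gtent_lty _ _ _ F) => // e'; exact: onF.
have := first_variation_ge0 p2 l0 hl nw Jw w0 fF HZphi Lp tents_ge0 wd z1 z2.
pose K := `|lambda| * (4 * r * M).
have K0 : 0 <= K by rewrite !mulr_ge0// ltW.
have step : \sum_(e' <- fset_set F)
     (\int[mu]_(x in edge_open e') (gderiv w e' x * tents' on ctr r e' x) +
      lambda * \int[mu]_(x in edge_open e') (w e' x * tents on ctr r e' x)) <=
    \sum_(e' <- fset_set F) (K - r^-1 * (S e' r true + S e' r false)).
  apply: ler_sum => e' _; rewrite integral_gderiv_tents'// addrC lerD2r.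
  have := integral_tents_le e' rr0 M0 wM.
  move: (\int[mu]_(x in edge_open e') (w e' x * tents on ctr r e' x)) => I /andP[I0 IM].
  apply: (@le_trans _ _ (`|lambda| * I)); first by rewrite ler_wpM2r// ler_norm.
  by rewrite ler_wpM2l.
move=> /le_trans/(_ step).
rewrite sumrB subr_ge0 -mulr_sumr big_const_seq count_predT iter_addr_0 => H.
have eF : e \in fset_set F by rewrite in_fset_set//; apply: mem_set; exact: onF eb.
have H2 : S e r b <= \sum_(e' <- fset_set F) (S e' r true + S e' r false).
  rewrite (big_rem e)//=; apply: ler_wpDr.
    by apply: sumr_ge0 => e' _; rewrite addr_ge0.
  by case: b {eb}; rewrite ?lerDl ?lerDr.
have : S e r b <= r * (K *+ size (fset_set F)).
  by apply: (le_trans H2); rewrite -ler_pdivrMl.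
rewrite {1}/S eb mul1r => /le_trans; apply.
rewrite /K -mulr_natr le_eqVlt; apply/orP; left; apply/eqP; ring.
Qed.

(** By [tent_fits] the part of the edge within [r0] of the centre lies in a segment of the edge,
    where [w] is bounded by compactness. *)
Lemma local_bound e b : on e b -> 0 < r0 ->
  exists M, forall x, edge_closed e x -> `|x - ctr e b| <= r0 -> w e x <= M.
Proof.
move=> eb r0_gt0; have [ec f1 f2] := fits eb; set c := ctr e b in ec f1 f2 *.
have [a [ea ac Ha]] : exists a, [/\ edge_closed e a, a <= c &
    forall x, edge_closed e x -> `|x - c| <= r0 -> a <= x].
  case: f1 => [c0|ea].
    by exists c; split => // x [x0 _] _; rewrite c0.
  exists (c - r0); split => //; first by rewrite gerBl ltW.
  by move=> x _; rewrite ler_norml; lra.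
have [d [ed cd Hd]] : exists d, [/\ edge_closed e d, c <= d &
    forall x, edge_closed e x -> `|x - c| <= r0 -> x <= d].
  case: f2 => [cl|ed].
    by exists c; split => // x [_ xl] _; rewrite -lee_fin -cl.
  exists (c + r0); split => //; first by rewrite lerDl ltW.
  by move=> x _; rewrite ler_norml; lra.
have cw : {within `[a, d], continuous (w e)}.
  apply: continuous_subspaceW (edge_closed_itv ea ed) _.
  exact: H1_continuous w_H1.
have [m _ Hm] := EVT_max (le_trans ac cd) cw.
exists (w e m) => x ex xc; apply: Hm.
by rewrite in_itv/= Ha// Hd.
Qed.

(** [halving] is applied with radius [|x - ctr e b|]: then [x] is one of the two points at that
    distance, and the other only adds a nonnegative value. *)
Lemma halving_step M : 0 < r0 -> 0 <= M ->
  4 * `|lambda| * (size (fset_set F))%:R * r0 ^+ 2 <= 2^-1 ->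
  (forall e b x, on e b -> edge_closed e x -> `|x - ctr e b| <= r0 -> w e x <= M) ->
  forall e b x, on e b -> edge_closed e x -> `|x - ctr e b| <= r0 -> w e x <= M / 2.
Proof.
move=> r0_gt0 M0 small wM e b x eb ex xc.
have [->|xneq] := eqVneq x (ctr e b).
  by rewrite w_ctr// divr_ge0.
pose r := `|x - ctr e b|.
have r_gt0 : 0 < r by rewrite normr_gt0 subr_eq0.
have H := @halving M r (introT andP (conj r_gt0 xc)) M0 wM e b eb.
have wx : w e x <= extend0 e (w e) (ctr e b - r) + extend0 e (w e) (ctr e b + r).
  have ext : extend0 e (w e) x = w e x by rewrite /extend0 asboolT.
  rewrite -{1}ext /r; case: (ler0P (x - ctr e b)) => _.
    by rewrite opprK subrKC lerDl extend0_ge0.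
  by rewrite subrKC lerDr extend0_ge0.
apply: (le_trans (le_trans wx H)); rewrite mulrC ler_wpM2l//.
apply: le_trans small; rewrite ler_wpM2l ?mulr_ge0//.
by rewrite lerXn2r// nnegrE ?ltW// ?(le_trans (ltW r_gt0)).
Qed.

(** The halved bound holds on the same neighbourhoods as the original one, so the step can be
    iterated without shrinking [r0], and [w] is at most [M / 2 ^ n] for every [n]. *)
Lemma vanishing_near_centers : 0 < r0 ->
  4 * `|lambda| * (size (fset_set F))%:R * r0 ^+ 2 <= 2^-1 ->
  forall e b x, on e b -> edge_closed e x -> `|x - ctr e b| <= r0 -> w e x = 0.
Proof.
move=> r0_gt0 small.
have [M [M0 wM]] : exists M, 0 <= M /\ forall e b x, on e b -> edge_closed e x ->
    `|x - ctr e b| <= r0 -> w e x <= M.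
  have /choice[m Hm] : forall h : edge G * bool, exists m, on h.1 h.2 -> forall x,
      edge_closed h.1 x -> `|x - ctr h.1 h.2| <= r0 -> w h.1 x <= m.
    move=> [e b] /=; case eb : (on e b); last by exists 0.
    by have [m Hm] := local_bound eb r0_gt0; exists m.
  have T0 e : 0 <= `|m (e, true)| + `|m (e, false)| by rewrite addr_ge0.
  exists (\sum_(e <- fset_set F) (`|m (e, true)| + `|m (e, false)|)); split.
    by apply: sumr_ge0 => e _; exact: T0.
  move=> e b x eb ex xc; apply: le_trans (Hm (e, b) eb x ex xc) _.
  have eF : e \in fset_set F by rewrite in_fset_set//; apply: mem_set; exact: onF eb.
  rewrite (big_rem e)//=; apply: ler_wpDr.
    by apply: sumr_ge0 => e' _; exact: T0.
  rewrite (le_trans (ler_norm _))//.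
  by case: b {eb xc}; rewrite ?lerDl ?lerDr.
have wn n : forall e b x, on e b -> edge_closed e x ->
    `|x - ctr e b| <= r0 -> w e x <= M / 2 ^+ n.
  elim: n => [|n IH]; first by rewrite expr0 divr1.
  have := halving_step r0_gt0 _ small IH; rewrite divr_ge0 ?exprn_ge0// => /(_ isT) H.
  move=> e b x eb ex xc; apply: le_trans (H e b x eb ex xc) _.
  by rewrite exprSr invfM mulrA.
move=> e b x eb ex xc; apply/eqP; rewrite eq_le; apply/andP; split; last first.
  by have [_ _ w0] := gs; exact: w0.
rewrite leNgt; apply/negP => wx.
have [n Mn] : exists n : nat, M / w e x < n%:R.
  by exists (Num.truncn (M / w e x)).+1; rewrite truncnS_gt.
have := wn n e b x eb ex xc.
rewrite ler_pdivlMr ?exprn_gt0// leNgt => /negP; apply.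
rewrite mulrC -ltr_pdivrMr//; apply: lt_le_trans Mn _.
by rewrite -natrX ler_nat ltnW// ltn_expl.
Qed.

End halving.

End vanishing.

(** * Propagation of zeros along edges and through vertices *)

Section propagation.
Variables (R : realType) (G : metric_graph R).
Variables (Z : set (vertex G)) (p lambda : R) (w : gfun G).
Hypotheses (p2 : 2 < p) (hG : class_G G) (hl : (- omega Z < lambda%:E)%E).
Hypothesis hZ : forall v, Z v -> ~ Vinf v /\ degree v = 1%N.
Hypothesis gs : nonneg_ground_state Z p lambda w.
Implicit Types (e : edge G) (v : vertex G) (b : bool) (r x : R).

Lemma len_lower_bound : exists2 d : R, 0 < d & forall e, (d%:E <= len e)%E.
Proof.
have [_ _ _ H] := hG.
have lb e : (ereal_inf (range (@len R G)) <= len e)%E.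
  by apply: ereal_inf_lbound; exists e.
move: H lb; case: (ereal_inf _) => [d| |] //.
  by rewrite lte_fin => d0 lb; exists d.
(* The infimum is infinite when every edge is a half-line, or when there is no edge; then any
   positive bound will do. *)
move=> _ lb; exists 1 => // e; have := lb e; rewrite leye_eq => /eqP ->.
by rewrite leey.
Qed.

Lemma len_gt0 e : (0 < len e)%E.
Proof.
by have [d d0 H] := len_lower_bound; apply: lt_le_trans (H e); rewrite lte_fin.
Qed.

Lemma small_radius (K d : R) : 0 <= K -> 0 < d ->
  exists r, [/\ 0 < r, r <= d & K * r ^+ 2 <= 2^-1].
Proof.
(* From [r <= 1] comes [K * r^2 <= K * r], and the last bound makes [K * r] at most one half. *)
move=> K0 d0; exists (Num.min d (Num.min 1 (2 * (K + 1))^-1)).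
set r := Num.min d _.
have K1 : 0 < 2 * (K + 1) by rewrite mulr_gt0// ltr_wpDl.
have r_gt0 : 0 < r by rewrite !lt_min d0 ltr01 invr_gt0 K1.
split => //; first by rewrite ge_min lexx.
have r1 : r <= 1 by rewrite !ge_min lexx orbT.
have r2 : r <= (2 * (K + 1))^-1 by rewrite !ge_min lexx !orbT.
have r3 : r * (2 * (K + 1)) <= 1 by rewrite -ler_pdivlMr// mul1r.
clearbody r; nra.
Qed.

Lemma interior_zero_near e (c r0 : R) :
  0 < r0 -> 4 * `|lambda| * r0 ^+ 2 <= 2^-1 ->
  edge_closed e (c - r0) -> edge_closed e (c + r0) -> w e c = 0 ->
  forall x, `|x - c| <= r0 -> w e x = 0.
Proof.
move=> r0_gt0 small el er wc x xc.
have ec : edge_closed e c by apply: (edge_closed_itv el er); rewrite /= in_itv/=; lra.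
have ex : edge_closed e x.
  by apply: (edge_closed_itv el er); rewrite /= in_itv/=; move: xc; rewrite ler_norml; lra.
pose on e' b := (e' == e) && b.
pose ctr (e' : edge G) (b : bool) := c.
have fF : finite_set [set e] by exact: finite_set1.
apply: (@vanishing_near_centers R G Z p lambda w [set e] on ctr r0 p2 len_gt0 hl gs fF
  _ _ _ _ _ r0_gt0 _ e true x) => //.
- by move=> e' b /andP[/eqP].
- by move=> e' b /andP[/eqP -> _]; split => //; right.
- by move=> e' b /andP[/eqP -> _].
(* The ends of [e] are at distance at least [r0] from [c], so the tent vanishes at all vertices and
   [tau] is 0. *)
- move=> r /andP[r_gt0 r_le]; exists (fun=> 0) => // h nV.
  have [c0 cl] : r0 <= c /\ ((c + r0)%:E <= len e)%E.
    by case: el er => c0 _ [_ cl]; split => //; rewrite -subr_ge0.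
  rewrite /trace /tents /gadd /gtent /on /ctr !andbT !andbF mul0r addr0.
  case: eqP => [he|_]; last by rewrite mul0r.
  rewrite mul1r tent_out//.
  case hb : h.2; last by rewrite sub0r normrN ger0_norm; lra.
  move: nV; rewrite /endpoint hb he => nV.
  move: cl nV; have := len_gt0 e; case E : (len e) => [l| |] //= l0; last first.
    by move=> _ nV; exfalso; apply: nV; exists e.
  rewrite lee_fin => cl _; rewrite ger0_norm; lra.
- by move=> v /hZ[].
- by rewrite fset_set1 cardfs1 mulr1.
- by rewrite /on eqxx.
Qed.

Lemma edge_open_itv_margin e (a d : R) : edge_open e a -> edge_open e d ->
  exists2 eta : R, 0 < eta & forall x, a <= x <= d ->
    edge_closed e (x - eta) /\ edge_closed e (x + eta).
Proof.
move=> [a0 _] [_ dl].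
have [c dc cl] : exists2 c, d < c & (c%:E <= len e)%E.
  by case: (len e) dl => [l| |]//= dl; [exists l|exists (d + 1); rewrite ?ltrDl ?leey].
exists (Num.min a (c - d)); first by rewrite lt_min a0 subr_gt0.
set eta := Num.min _ _.
have ea : eta <= a by rewrite ge_min lexx.
have ec : eta <= c - d by rewrite ge_min lexx orbT.
have e0 : 0 < eta by rewrite lt_min a0 subr_gt0.
clearbody eta => x /andP[ax xd]; split; split.
- by lra.
- by apply: le_trans cl; rewrite lee_fin; lra.
- by lra.
- by apply: le_trans cl; rewrite lee_fin; lra.
Qed.

(** The segment between [c] and [y] keeps a positive distance from the ends of the edge, so one
    radius [h] serves at all its points and the zeros advance by [h] at each step. *)
Lemma interior_zero_edge e (c y : R) : edge_open e c -> edge_open e y ->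
  w e c = 0 -> w e y = 0.
Proof.
move=> Oc Oy wc.
have [a [d [Oa Od Hc Hy]]] : exists a d : R, [/\ edge_open e a, edge_open e d,
    a <= c <= d & a <= y <= d].
  have [cy|yc] := leP c y; [exists c, y|exists y, c]; split => //; lra.
have [eta eta0 He] := edge_open_itv_margin Oa Od.
have L0 : 0 <= 4 * `|lambda| by rewrite mulr_ge0.
have [h [h0 he hs]] := small_radius L0 eta0.
have margin x : a <= x <= d -> edge_closed e (x - h) /\ edge_closed e (x + h).
  move=> xad; have [H1 H2] := He x xad; split;
    apply: (edge_closed_itv H1 H2); rewrite /= in_itv/=; lra.
have near x t : a <= x <= d -> w e x = 0 -> `|t - x| <= h -> w e t = 0.
  by move=> xad wx; have [H1 H2] := margin x xad; exact: interior_zero_near h0 hs H1 H2 wx t.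
have H n : forall t, a <= t <= d -> `|t - c| <= n%:R * h -> w e t = 0.
  elim: n => [|n IH] t tad tc.
    by move: tc; rewrite mul0r normr_le0 subr_eq0 => /eqP ->.
  have [tn|tn] := leP `|t - c| (n%:R * h); first exact: IH.
  have n0 : 0 <= n%:R * h by rewrite mulr_ge0// ltW.
  move: tc; rewrite -natr1 mulrDl mul1r => tc.
  move: (n%:R * h) n0 tc tn IH => A A0 tc tn IH.
  (* With [A = n * h], the point at distance [A] from [c] on the side of [t] is a zero by induction,
     and [t] is within [h] of it. *)
  have [tlt|tge] := leP t c.
    have tc' : `|t - c| = c - t by rewrite distrC ger0_norm// subr_ge0.
    rewrite tc' in tc tn.
    apply: (near (c - A)); first by lra.
      by apply: IH; [lra|rewrite addrAC subrr sub0r normrN ger0_norm].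
    by rewrite ler_norml; lra.
  have tc' : `|t - c| = t - c by rewrite ger0_norm// subr_ge0 ltW.
  rewrite tc' in tc tn.
  apply: (near (c + A)); first by lra.
    by apply: IH; [lra|rewrite addrAC subrr add0r ger0_norm].
  by rewrite ler_norml; lra.
have [n Hn] : exists n : nat, `|y - c| / h < n%:R.
  by exists (Num.truncn (`|y - c| / h)).+1; rewrite truncnS_gt.
by apply: (H n) => //; rewrite -ler_pdivrMr// ltW.
Qed.

Lemma gs_H1 : H1 w. Proof. by have [[[]]] := gs. Qed.

(** Density of the open edge in the closed one, obtained from the positivity of the [L^2] norm. *)
Lemma open_zero_closed (f : R -> R) e : {within edge_closed e, continuous f} ->
  (forall x, edge_open e x -> f x = 0) -> forall x, edge_closed e x -> f x = 0.
Proof.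
move=> cf f0 x ex; apply/eqP; apply/negPn/negP => fx.
have := edge_Lqpow2_gt0 (len_gt0 e) cf ex fx.
rewrite edge_Lqpow2E integral0_eq ?ltxx// => t Ot.
by rewrite f0// expr0n.
Qed.

Definition zero_edge e : Prop := forall x, edge_closed e x -> w e x = 0.

Lemma interior_zero e (c : R) : edge_open e c -> w e c = 0 -> zero_edge e.
Proof.
move=> Oc wc; apply: open_zero_closed; first exact: H1_continuous gs_H1.
by move=> x Ox; exact: (interior_zero_edge Oc Ox wc).
Qed.

Lemma edge_closed0 e : edge_closed e 0.
Proof. by split => //; exact: ltW (len_gt0 e). Qed.

Lemma edge_closed_len e (l : R) : len e = l%:E -> edge_closed e l.
Proof. by move=> E; split; rewrite ?E// -lee_fin -E; exact: ltW (len_gt0 e). Qed.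

(** Tents on all half-edges at [v] form one continuous function equal to 1 at [v], admissible as [v]
    is not in [Z]; this takes the place of a Kirchhoff condition. Finite degree makes the sum
    finite, and the lower bound on the lengths gives one radius for all the edges. *)
Lemma vertex_zero v : ~ Vinf v -> ~ Z v ->
  (forall h : half_edge G, endpoint h = v -> trace w h = 0) ->
  forall h : half_edge G, endpoint h = v -> zero_edge h.1.
Proof.
move=> nV nZ wv.
have [_ fstar _ _] := hG.
have fin_len e : tgt e = v -> exists l, len e = l%:E.
  move=> tv; have := len_gt0 e; case E : (len e) => [l| |] //= _; first by exists l.
  by exfalso; apply: nV; exists e.
pose F := [set h.1 | h in star v].
have fF : finite_set F by apply: finite_image; exact: fstar.
have [d d0 Hd] := len_lower_bound.
have L0 : 0 <= 4 * `|lambda| * (size (fset_set F))%:R by rewrite !mulr_ge0.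
have [r0 [r0_gt0 r0d small]] := small_radius L0 d0.
have r0_len e : (r0%:E <= len e)%E by apply: le_trans (Hd e); rewrite lee_fin.
pose on e b := endpoint ((e, b) : half_edge G) == v.
pose ctr (e : edge G) b : R := if b then fine (len e) else 0.
have van := @vanishing_near_centers R G Z p lambda w F on ctr r0 p2 len_gt0 hl gs fF.
have {}van : forall e b x, on e b -> edge_closed e x -> `|x - ctr e b| <= r0 -> w e x = 0.
  apply: van => //.
  - by move=> e b /eqP eb; exists (e, b).
  - move=> e [] /eqP eb; rewrite /ctr; have ec0 := edge_closed0 e.
      have [l El] := fin_len e eb; have el := edge_closed_len El.
      have r0l := r0_len e; rewrite El lee_fin in r0l.
      rewrite El /=; split; [exact: el|right|by left].
      by apply: (edge_closed_itv ec0 el); rewrite /= in_itv/=; lra.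
    split; [exact: ec0|by left|right]; rewrite add0r; split; [exact: ltW|exact: r0_len].
  - by move=> e b /eqP eb; exact: (wv (e, b) eb).
  - move=> r /andP[r_gt0 r_le]; exists (fun u => (u == v)%:R) => [u Zu|].
      by case: eqP => // uv; exfalso; apply: nZ; rewrite -uv.
    have r_len e : (r%:E <= len e)%E by apply: le_trans (r0_len e); rewrite lee_fin.
    move=> [e b] nVh; rewrite /trace /tents /gadd /gtent /on /ctr /=.
    case: b nVh; rewrite /endpoint/= => nVh.
      have [l El] : exists l, len e = l%:E.
        have := len_gt0 e; case E : (len e) => [l| |] //= _; first by exists l.
        by exfalso; apply: nVh; exists e.
      have rl := r_len e; rewrite El lee_fin in rl.
      rewrite El /= tent_center// mulr1.
      (* The tent at the source has radius at most the length of the edge and is 0 at the target, so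
         a loop at [v] has the value 1, and not 2, at either end. *)
      have -> : tent 0 r l = 0.
        by apply: tent_out => //; rewrite subr0 ger0_norm// (le_trans (ltW r_gt0)).
      by rewrite mulr0 addr0.
    rewrite tent_center// mulr1.
    case: eqP => [tv|_]; last by rewrite mul0r add0r.
    have [l El] := fin_len e tv; have rl := r_len e; rewrite El lee_fin in rl.
    have -> : tent (fine (len e)) r 0 = 0.
      rewrite El; apply: tent_out => //=.
      by rewrite sub0r normrN ger0_norm// (le_trans (ltW r_gt0)).
    by rewrite mulr0 add0r.
  - by move=> u /hZ[].
move=> [e b] eb /=.
have on_eb : on e b by apply/eqP.
(* The point at distance [r0 / 2] from the end is interior to the edge, so the zeros found near the
   vertex spread to the whole edge. *)
have half0 : 0 < r0 / 2 by rewrite divr_gt0.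
have halfl : r0 / 2 < r0 by rewrite ltr_pdivrMr// ltr_pMr// ltr1n.
case: b eb on_eb => eb on_eb.
  have [l El] := fin_len e eb; have rl := r0_len e; rewrite El lee_fin in rl.
  have Oc : edge_open e (l - r0 / 2).
    by split; rewrite ?El ?lte_fin ?subr_gt0 ?(lt_le_trans halfl)// gtrBl.
  apply: (interior_zero Oc); apply: (van e true _ on_eb (edge_open_closed Oc)).
  by rewrite /ctr El /= addrAC subrr sub0r normrN ger0_norm ?ltW.
have Oc : edge_open e (r0 / 2).
  by split => //; apply: lt_le_trans (r0_len e); rewrite lte_fin.
apply: (interior_zero Oc); apply: (van e false _ on_eb (edge_open_closed Oc)).
by rewrite /ctr subr0 ger0_norm ?ltW.
Qed.

Lemma degree1_unique v (h1 h2 : half_edge G) : degree v = 1%N ->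
  endpoint h1 = v -> endpoint h2 = v -> h1 = h2.
Proof.
have [_ fstar _ _] := hG.
move=> /eqP /cardfs1P[h E] e1 e2.
have mem h' : endpoint h' = v -> h' = h.
  move=> e'; have : h' \in fset_set (star v).
    by rewrite in_fset_set; [apply: mem_set|exact: fstar].
  by rewrite E inE => /eqP.
by rewrite (mem _ e1) (mem _ e2).
Qed.

Lemma zero_edge_trace (h : half_edge G) : zero_edge h.1 ->
  ~ Vinf (endpoint h) -> trace w h = 0.
Proof.
case: h => e b /= ze nV; rewrite /trace/=; apply: ze.
case: b nV => /= nV; last exact: edge_closed0.
have := len_gt0 e; case E : (len e) => [l| |] //= _; first exact: edge_closed_len.
by exfalso; apply: nV; exists e.
Qed.

Definition zero_star v : Prop :=
  forall h : half_edge G, endpoint h = v -> zero_edge h.1.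

(** [vertex_zero] covers the vertices that are neither in [Z] nor at infinity. The others have
    degree 1, and their star is the half-edge [h] alone. *)
Lemma zero_edge_star (h : half_edge G) : zero_edge h.1 -> zero_star (endpoint h).
Proof.
move=> zh; have [_ _ degV _] := hG.
have [dv|dv] := pselect (Vinf (endpoint h) \/ Z (endpoint h)).
  have d1 : degree (endpoint h) = 1%N by case: dv => [/degV|/hZ[]].
  by move=> h' eh'; rewrite (degree1_unique d1 eh' erefl).
have nV : ~ Vinf (endpoint h) by move=> V; apply: dv; left.
have nZ : ~ Z (endpoint h) by move=> V; apply: dv; right.
apply: (vertex_zero nV nZ) => h' eh'.
have [[_ tw] _ _ _] := gs_H1.
rewrite -(zero_edge_trace zh nV); apply: tw => //.
by rewrite eh'.
Qed.

(** An equivalence, so that the induction passes through the symmetric closure in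
    [connected_graph]. *)
Lemma zero_star_connected v1 v2 : zero_star v1 <-> zero_star v2.
Proof.
have [conn _ _ _] := hG.
elim: (conn v1 v2) => [x y [e ex ey]|x|x y _ IH|x y z _ IH1 _ IH2].
- split => H.
    by rewrite -ey; apply: (@zero_edge_star (e, true)); exact: (H (e, false)).
  by rewrite -ex; apply: (@zero_edge_star (e, false)); exact: (H (e, true)).
- by [].
- by split => /IH.
- by split => [/IH1/IH2|/IH2/IH1].
Qed.

Lemma strong_maximum_principle e (c : R) : edge_open e c -> w e c <> 0.
Proof.
move=> Oc wc; have ze := interior_zero Oc wc.
have zs : zero_star (src e) by exact: (@zero_edge_star (e, false)).
have [[_ [e1 [x [ex wx]]] _] _ _] := gs.
have zs1 : zero_star (src e1) by apply/(zero_star_connected (src e) (src e1)).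
by move: wx; rewrite (zs1 (e1, false) erefl _ ex) eqxx.
Qed.

End propagation.

(** * Comparison of the two infima *)

Lemma mule2 (R : realType) (x : \bar R) : (2%:E * x = x + x)%E.
Proof.
case: x => [x| |].
- by rewrite -EFinM -EFinD; congr (_%:E); rewrite mulr_natl mulr2n.
- by rewrite mulry gtr0_sg// mul1e.
- by rewrite mulrNy gtr0_sg// mul1e.
Qed.

(** The summands are real, which excludes an infinite [m]; neither can then exceed [m], since the
    other does not fall below it. *)
Lemma adde_lower_bound_eq (R : realType) (m : \bar R) (a b : R) :
  (m <= a%:E)%E -> (m <= b%:E)%E -> (a%:E + b%:E = m + m)%E -> a%:E = m.
Proof.
case: m => [m| |] //=; rewrite !lee_fin => ma mb [] E; congr (_%:E); lra.
Qed.

Theorem theorem1p4 (R : realType) (p : R) (hp : 2 < p)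
    (G : metric_graph R) (hG : class_G G) (hnc : noncompact_graph G)
    (Z : set (vertex G))
    (hZ : forall v, Z v -> ~ Vinf v /\ degree v = 1%N)
    (lambda : R) (hlambda : (- omega Z < lambda%:E)%E) :
  (2%:E * ereal_inf [set J p lambda v | v in nehari Z p lambda]
     <= ereal_inf [set J p lambda v | v in nodal_nehari Z p lambda])%E /\
  (ereal_inf [set J p lambda v | v in nodal_nehari Z p lambda]
     = 2%:E * ereal_inf [set J p lambda v | v in nehari Z p lambda] ->
   ~ exists u, nodal_ground_state Z p lambda u)%E.
Proof.
have p0 : p != 0 by rewrite gt_eqF// (lt_trans _ hp).
set m := ereal_inf [set J p lambda v | v in nehari Z p lambda].
have lb v : nehari Z p lambda v -> (m <= J p lambda v)%E.
  by move=> nv; apply: ereal_inf_lbound; exists v.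
split.
  apply: le_ereal_inf_tmp => _ [u nu <-]; have [_ np nn] := nu.
  by rewrite (J_posneg p0 nu) mule2 leeD// lb.
move=> infE [u [nu Ju]]; have [_ np nn] := nu.
move: Ju; rewrite infE (J_posneg p0 nu) mule2 => JE.
have Jp : J p lambda (gpos u) = m.
  move: (lb _ np) (lb _ nn) JE; rewrite (J_nehari np) (J_nehari nn).
  exact: adde_lower_bound_eq.
have gs : nonneg_ground_state Z p lambda (gpos u).
  by split => // e x _; rewrite /gpos le_max lexx orbT.
have [_ [e [x [ex ux]]] _] := nn.
have [[Hn _] _ _] := nn.
(* On the edge [e], where [u^-] is nonzero at [x], the strong maximum principle makes [u^+] positive
   at every interior point. Hence [u^-] vanishes inside the edge and, by continuity, also at its
   ends, a contradiction at [x]. *)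
have Hneg : forall y, edge_closed e y -> gneg u e y = 0.
  apply: (open_zero_closed hG); first exact: H1_continuous Hn.
  move=> y Oy; have := strong_maximum_principle hp hG hlambda hZ gs Oy.
  by rewrite /gpos /gneg; case: (leP (u e y) 0).
by move: ux; rewrite Hneg// eqxx.
Qed.
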